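(* Let $V\subseteq\mathbb{D}^2$ and assume that $V$ is relatively polynomially convex, i.e. $V^\wedge\cap\mathbb{D}^2=V$. If $V$ has the polynomial extension property, then $V$ is balanced.
   Context: $\mathbb{D}$ is the open unit disk. $V^\wedge$ denotes the polynomially convex hull of $V$: $V^\wedge=\{\lambda\in\mathbb{C}^2 : |p(\lambda)|\le\sup_V|p|\text{ for every polynomial }p\text{ in two variables}\}$. $V$ has the polynomial extension property if for every polynomial $p$ in two variables there is a bounded holomorphic function $g$ on $\mathbb{D}^2$ with $g|_V=p|_V$ and $\sup_{\mathbb{D}^2}|g|=\sup_V|p|$. Let $d(\mu_1,\mu_2)=\left|\frac{\mu_1-\mu_2}{1-\overline{\mu_1}\mu_2}\right|$ be the pseudo-hyperbolic metric on $\mathbb{D}$. Superscripts denote coordinates. A pair $\lambda=(\lambda_1,\lambda_2)$ of distinct points $\lambda_i=(\lambda_i^1,\lambda_i^2)\in\mathbb{D}^2$ is a balanced pair if $d(\lambda_1^1,\lambda_2^1)=d(\lambda_1^2,\lambda_2^2)$. For a balanced pair $\lambda$ there is a unique holomorphic $f:\mathbb{D}\to\mathbb{D}$ with $f(\lambda_i^1)=\lambda_i^2$ for $i=1,2$ (it is an automorphism of $\mathbb{D}$), and $D_\lambda=\{(z,f(z)):z\in\mathbb{D}\}$. A set $V\subseteq\mathbb{D}^2$ is balanced if $D_\lambda\subseteq V$ whenever $\lambda$ is a balanced pair of points of $V$. *)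

(* Defs.v *)
(* Stdlib reals with Coquelicot's complex numbers C. *)
From Stdlib Require Import Reals.
From Coquelicot Require Import Coquelicot.

Open Scope C_scope.

Definition disk (z : C) : Prop := (Cmod z < 1)%R.

Definition bidisk (z : C * C) : Prop := disk (fst z) /\ disk (snd z).

(* Polynomials in two variables over C, identified with the functions they
   induce on C^2 (C is infinite). *)
Definition polynomial2 (p : C * C -> C) : Prop :=
  exists (N : nat) (a : nat -> nat -> C), forall z : C * C,
    p z = sum_n (fun i => sum_n (fun j => a i j * fst z ^ i * snd z ^ j) N) N.

(* Supremum of |f| over V in the extended reals; it is m_infty for empty V. *)
Definition sup_mod (V : C * C -> Prop) (f : C * C -> C) : Rbar :=
  Lub_Rbar (fun r : R => exists z : C * C, V z /\ r = Cmod (f z)).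

(* Complex (Frechet) differentiability at every point: the differential is
   linear over C_AbsRing.  The values of g outside the bidisk are irrelevant. *)
Definition holomorphic_bidisk (g : C * C -> C) : Prop :=
  forall z : C * C, bidisk z ->
    ex_filterdiff (K := C_AbsRing)
      (U := prod_NormedModule C_AbsRing C_NormedModule C_NormedModule)
      (V := C_NormedModule) g (locally z).

Definition bounded_bidisk (g : C * C -> C) : Prop :=
  exists M : R, forall z : C * C, bidisk z -> (Cmod (g z) <= M)%R.

Definition holomorphic_disk (f : C -> C) : Prop :=
  forall z : C, disk z -> ex_derive (K := C_AbsRing) (V := C_NormedModule) f z.

Definition poly_hull (V : C * C -> Prop) (l : C * C) : Prop :=
  forall p : C * C -> C, polynomial2 p -> Rbar_le (Cmod (p l)) (sup_mod V p).

Definition rel_poly_convex (V : C * C -> Prop) : Prop :=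
  forall l : C * C, (poly_hull V l /\ bidisk l) <-> V l.

Definition poly_extension_property (V : C * C -> Prop) : Prop :=
  forall p : C * C -> C, polynomial2 p ->
    exists g : C * C -> C,
      holomorphic_bidisk g /\ bounded_bidisk g /\
      (forall z : C * C, V z -> g z = p z) /\
      sup_mod bidisk g = sup_mod V p.

Definition pseudo_hyp (m1 m2 : C) : R := Cmod ((m1 - m2) / (1 - Cconj m1 * m2)).

Definition balanced_pair (l1 l2 : C * C) : Prop :=
  bidisk l1 /\ bidisk l2 /\ l1 <> l2 /\
  pseudo_hyp (fst l1) (fst l2) = pseudo_hyp (snd l1) (snd l2).

Definition disk_interpolant (l1 l2 : C * C) (f : C -> C) : Prop :=
  holomorphic_disk f /\ (forall z : C, disk z -> disk (f z)) /\
  f (fst l1) = snd l1 /\ f (fst l2) = snd l2.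

(* For a balanced pair the interpolant exists and is unique on the disk, so
   this set is the graph over the disk of that one function. *)
Definition D_pair (l1 l2 : C * C) (w : C * C) : Prop :=
  exists f : C -> C, disk_interpolant l1 l2 f /\
    exists z : C, disk z /\ w = (z, f z).

Definition balanced (V : C * C -> Prop) : Prop :=
  forall l1 l2 : C * C, V l1 -> V l2 -> balanced_pair l1 l2 ->
    forall w : C * C, D_pair l1 l2 w -> V w.

(* Main.v *)
Require Import Defs.
From Stdlib Require Import Reals Lra Lia Classical.
From Coquelicot Require Import Coquelicot.

(* After Moebius changes of the two coordinates, D_lambda is the diagonal {(t, t)} and the nodes are
   (0, 0) and (c, c).  A function phi = (x + y)/2 is extremal for this pair in the bidisk by the
   Schwarz lemma, and on the closed bidisk its modulus is 1 only at the points (t, t) with |t| = 1.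
   If the closure of V missed such a point, phi could be multiplied by a factor S(phi) so that
   |phi S(phi)| <= 1 on V while |c S(c)| > |c|; a polynomial close to phi S(phi) would then have no
   extension of the same norm.  So the closure of V contains the boundary curve of D_lambda, and by
   the maximum principle D_lambda lies in the polynomial hull of V.

   The maximum principle and the Schwarz lemma are needed for functions that are merely complex
   differentiable at every point; they follow from the mean value property, which is Goursat's
   theorem for k(e^(s + i th)) on the rectangles [s0, s1] x [0, 2 pi]. *)

Open Scope R_scope.

(** * Goursat's theorem on rectangles *)


(** The factor S is a first-order perturbation 1 + d H of the constant 1, with d small. Where |phi|
    stays away from 1 there is room for any small perturbation; near the circle but away from the
    missed point, |1 + d H| <= 1 calls for Re H < 0; at the second node, |1 + d H| > 1 calls for Re
    H > 0. A Herglotz kernel peaked at the missed point, minus a constant, has both signs. The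
    strict gain at the node leaves room for replacing phi S by a polynomial.

    The Schwarz lemma divides by a zero, and the quotient is only known to be continuous there:
    differentiability would be Riemann's theorem on removable singularities. Hence the mean value
    property admits one exceptional point. It evaluates a function only at the centre of the
    circles, so each estimate first moves the point of interest to 0 by a Moebius map, and the zero
    becomes the exceptional point. *)

Definition flux (u v : R -> R -> R) (a b c d : R) : R :=
  (RInt (u b) c d - RInt (u a) c d)
  - (RInt (fun x => v x d) a b - RInt (fun x => v x c) a b).

(** [flux] is the imaginary part of the contour integral of u + iv over the boundary, that is, the
    outward flux of the field (u, -v). The shared [l] is the Cauchy-Riemann equation u_x = v_y,
    which makes the divergence of this field 0. *)
Definition divergence_free_at (u v : R -> R -> R) (x y : R) : Prop :=
  exists l m n : R,
    differentiable_pt_lim u x y l m /\ differentiable_pt_lim v x y n l.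

Lemma continuity_2d_pt_slice_l (f : R -> R -> R) (x y : R) :
  continuity_2d_pt f x y -> continuous (f x) y.
Proof.
intros H; apply continuity_pt_filterlim; intros eps Heps.
destruct (H (mkposreal eps Heps)) as [d Hd].
exists d; split; [apply cond_pos|].
intros z [_ Hz]; apply Hd; [rewrite Rminus_diag, Rabs_R0; apply cond_pos|exact Hz].
Qed.

Lemma continuity_2d_pt_slice_r (f : R -> R -> R) (x y : R) :
  continuity_2d_pt f x y -> continuous (fun z => f z y) x.
Proof.
intros H; apply continuity_pt_filterlim; intros eps Heps.
destruct (H (mkposreal eps Heps)) as [d Hd].
exists d; split; [apply cond_pos|].
intros z [_ Hz]; apply Hd; [exact Hz|rewrite Rminus_diag, Rabs_R0; apply cond_pos].
Qed.

Definition continuous_on_rect (f : R -> R -> R) (a b c d : R) : Prop :=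
  forall x y : R, a <= x <= b -> c <= y <= d -> continuity_2d_pt f x y.

Lemma ex_RInt_slice_l (f : R -> R -> R) (a b c d x y1 y2 : R) :
  continuous_on_rect f a b c d -> a <= x <= b -> c <= y1 -> y1 <= y2 -> y2 <= d ->
  ex_RInt (f x) y1 y2.
Proof.
intros H Hx H1 H2 H3; apply (ex_RInt_continuous (V := R_CompleteNormedModule)).
intros z; rewrite Rmin_left, Rmax_right by lra; intros Hz.
apply continuity_2d_pt_slice_l, H; lra.
Qed.

Lemma ex_RInt_slice_r (f : R -> R -> R) (a b c d y x1 x2 : R) :
  continuous_on_rect f a b c d -> c <= y <= d -> a <= x1 -> x1 <= x2 -> x2 <= b ->
  ex_RInt (fun x => f x y) x1 x2.
Proof.
intros H Hy H1 H2 H3; apply (ex_RInt_continuous (V := R_CompleteNormedModule)).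
intros z; rewrite Rmin_left, Rmax_right by lra; intros Hz.
apply continuity_2d_pt_slice_r, H; lra.
Qed.

Lemma flux_split (u v : R -> R -> R) (a m b c n d : R) :
  continuous_on_rect u a b c d -> continuous_on_rect v a b c d ->
  a <= m <= b -> c <= n <= d ->
  flux u v a b c d =
    flux u v a m c n + flux u v m b c n + flux u v a m n d + flux u v m b n d.
Proof.
intros Hu Hv Hm Hn; unfold flux.
assert (Eu : forall x, a <= x <= b -> RInt (u x) c d = RInt (u x) c n + RInt (u x) n d).
{ intros x Hx; symmetry.
  apply (RInt_Chasles (V := R_CompleteNormedModule));
    apply (ex_RInt_slice_l u a b c d); auto; lra. }
assert (Ev : forall y, c <= y <= d -> RInt (fun x => v x y) a b
   = RInt (fun x => v x y) a m + RInt (fun x => v x y) m b).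
{ intros y Hy; symmetry.
  apply (RInt_Chasles (V := R_CompleteNormedModule));
    apply (ex_RInt_slice_r v a b c d); auto; lra. }
rewrite (Eu a), (Eu b), (Ev c), (Ev d) by lra; ring.
Qed.

Lemma RInt_increment (f g : R -> R) (k a b e : R) :
  a <= b -> ex_RInt f a b -> ex_RInt g a b ->
  (forall x, a <= x <= b -> Rabs (f x - g x - k) <= e) ->
  Rabs (RInt f a b - RInt g a b - k * (b - a)) <= (b - a) * e.
Proof.
intros Hab Hf Hg H.
assert (E : is_RInt (fun x => f x - g x - k) a b (RInt f a b - RInt g a b - k * (b - a))).
{ replace (k * (b - a)) with (scal (b - a) k) by (unfold scal; simpl; unfold mult; simpl; ring).
  apply (is_RInt_minus (V := R_NormedModule) (fun x => f x - g x) (fun _ => k)).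
  - apply (is_RInt_minus (V := R_NormedModule) f g);
      apply (RInt_correct (V := R_CompleteNormedModule)); assumption.
  - apply (is_RInt_const (V := R_NormedModule)). }
rewrite <- (is_RInt_unique _ _ _ _ E).
apply abs_RInt_le_const; auto; eexists; exact E.
Qed.

(** The affine parts of [u] and [v] contribute l * (b - a) * (d - c) with opposite signs and cancel.
    What remains is at most eps * M on each of the four sides, whose lengths are at most M. *)
Lemma flux_local_bound (u v : R -> R -> R) (x y eps : R) :
  divergence_free_at u v x y -> 0 < eps ->
  exists delta : R, 0 < delta /\
    forall a b c d M : R, a <= x <= b -> c <= y <= d -> b - a <= M -> d - c <= M -> M < delta ->
      continuous_on_rect u a b c d -> continuous_on_rect v a b c d ->
      Rabs (flux u v a b c d) <= 4 * eps * M ^ 2.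
Proof.
intros (l & m & n & Du & Dv) Heps.
destruct (Du (mkposreal eps Heps)) as [d1 H1].
destruct (Dv (mkposreal eps Heps)) as [d2 H2].
exists (Rmin d1 d2); split; [apply Rmin_pos; apply cond_pos|].
intros a b c d M Hx Hy Hab Hcd HM Cu Cv.
assert (HM1 : M < d1) by (eapply Rlt_le_trans; [exact HM|apply Rmin_l]).
assert (HM2 : M < d2) by (eapply Rlt_le_trans; [exact HM|apply Rmin_r]).
assert (R1 : forall s t, a <= s <= b -> c <= t <= d ->
  Rabs (u s t - u x y - (l * (s - x) + m * (t - y))) <= eps * M).
{ intros s t Hs Ht; eapply Rle_trans;
    [apply H1; apply Rle_lt_trans with (2 := HM1); apply Rabs_le; lra|].
  simpl; apply Rmult_le_compat_l; [lra|]; apply Rmax_lub; apply Rabs_le; lra. }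
assert (R2 : forall s t, a <= s <= b -> c <= t <= d ->
  Rabs (v s t - v x y - (n * (s - x) + l * (t - y))) <= eps * M).
{ intros s t Hs Ht; eapply Rle_trans;
    [apply H2; apply Rle_lt_trans with (2 := HM2); apply Rabs_le; lra|].
  simpl; apply Rmult_le_compat_l; [lra|]; apply Rmax_lub; apply Rabs_le; lra. }
unfold flux.
pose proof (RInt_increment (u b) (u a) (l * (b - a)) c d (2 * (eps * M))) as I1.
pose proof (RInt_increment (fun x => v x d) (fun x => v x c) (l * (d - c)) a b (2 * (eps * M))) as I2.
assert (J1 : Rabs (RInt (u b) c d - RInt (u a) c d - l * (b - a) * (d - c)) <= (d - c) * (2 * (eps * M))).
{ apply I1; try lra; try (apply (ex_RInt_slice_l u a b c d); auto; lra).
  intros t Ht; pose proof (R1 a t ltac:(lra) Ht) as Ra; pose proof (R1 b t ltac:(lra) Ht) as Rb.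
  apply Rabs_le_between in Ra; apply Rabs_le_between in Rb; apply Rabs_le; lra. }
assert (J2 : Rabs (RInt (fun x => v x d) a b - RInt (fun x => v x c) a b - l * (d - c) * (b - a)) <= (b - a) * (2 * (eps * M))).
{ apply I2; try lra; try (apply (ex_RInt_slice_r v a b c d); auto; lra).
  intros s Hs; pose proof (R2 s c Hs ltac:(lra)) as Ra; pose proof (R2 s d Hs ltac:(lra)) as Rb.
  apply Rabs_le_between in Ra; apply Rabs_le_between in Rb; apply Rabs_le; lra. }
assert (HM0 : 0 <= eps * M) by (apply Rmult_le_pos; lra).
assert ((d - c) * (2 * (eps * M)) <= M * (2 * (eps * M))) by (apply Rmult_le_compat_r; lra).
assert ((b - a) * (2 * (eps * M)) <= M * (2 * (eps * M))) by (apply Rmult_le_compat_r; lra).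
apply Rabs_le_between in J1; apply Rabs_le_between in J2; apply Rabs_le; lra.
Qed.

(** A choice made by [Rle_dec] lets [corner] be a plain recursion. The fourth quarter is the
    default: by the triangle inequality it carries enough flux when the other three do not. *)
Definition bisect (u v : R -> R -> R) (w h : R) (p : R * R) : R * R :=
  let (x, y) := p in
  let F := fun x y => Rabs (flux u v x (x + w / 2) y (y + h / 2)) in
  let F0 := Rabs (flux u v x (x + w) y (y + h)) / 4 in
  if Rle_dec F0 (F x y) then (x, y)
  else if Rle_dec F0 (F (x + w / 2) y) then (x + w / 2, y)
  else if Rle_dec F0 (F x (y + h / 2)) then (x, y + h / 2)
  else (x + w / 2, y + h / 2).

Lemma bisect_corner (u v : R -> R -> R) (w h x y : R) :
  0 <= w -> 0 <= h ->
  let q := bisect u v w h (x, y) in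
  x <= fst q <= x + w / 2 /\ y <= snd q <= y + h / 2.
Proof.
intros Hw Hh; simpl.
repeat (destruct (Rle_dec _ _); [simpl; lra|]); simpl; lra.
Qed.

Lemma bisect_flux (u v : R -> R -> R) (w h x y : R) :
  0 <= w -> 0 <= h ->
  continuous_on_rect u x (x + w) y (y + h) -> continuous_on_rect v x (x + w) y (y + h) ->
  let q := bisect u v w h (x, y) in
  Rabs (flux u v x (x + w) y (y + h)) / 4
  <= Rabs (flux u v (fst q) (fst q + w / 2) (snd q) (snd q + h / 2)).
Proof.
intros Hw Hh Cu Cv; simpl.
repeat (destruct (Rle_dec _ _) as [?|?]; [simpl; assumption|]); simpl.
pose proof (flux_split u v x (x + w / 2) (x + w) y (y + h / 2) (y + h) Cu Cv ltac:(lra) ltac:(lra)) as E.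
replace (x + w / 2 + w / 2) with (x + w) in * by lra.
replace (y + h / 2 + h / 2) with (y + h) in * by lra.
match type of E with _ = ?A + ?B + ?C + ?D =>
  pose proof (Rabs_triang (A + B + C) D); pose proof (Rabs_triang (A + B) C);
  pose proof (Rabs_triang A B) end.
rewrite <- E in *. lra.
Qed.

Fixpoint corner (u v : R -> R -> R) (w h : R) (p : R * R) (k : nat) : R * R :=
  match k with
  | O => p
  | S k => bisect u v (w / 2 ^ k) (h / 2 ^ k) (corner u v w h p k)
  end.

Lemma pow2_pos (k : nat) : 0 < 2 ^ k.
Proof. apply pow_lt; lra. Qed.

Lemma div_pow2_pos (w : R) (k : nat) : 0 <= w -> 0 <= w / 2 ^ k.
Proof. intros Hw; apply Rmult_le_pos; [exact Hw|apply Rlt_le, Rinv_0_lt_compat, pow2_pos]. Qed.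

Lemma div_pow2_S (w : R) (k : nat) : w / 2 ^ S k = w / 2 ^ k / 2.
Proof. pose proof (pow2_pos k); simpl; field; lra. Qed.

(* Goursat's bisection argument, for a merely differentiable field. *)
Lemma flux_zero (u v : R -> R -> R) (a b c d : R) :
  a <= b -> c <= d ->
  (forall x y : R, a <= x <= b -> c <= y <= d -> divergence_free_at u v x y) ->
  flux u v a b c d = 0.
Proof.
intros Hab Hcd H.
assert (Cu : continuous_on_rect u a b c d).
{ intros x y Hx Hy; destruct (H x y Hx Hy) as (l & m & n & D & _).
  apply differentiable_continuity_pt; exists l, m; exact D. }
assert (Cv : continuous_on_rect v a b c d).
{ intros x y Hx Hy; destruct (H x y Hx Hy) as (l & m & n & _ & D).
  apply differentiable_continuity_pt; exists n, l; exact D. }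
set (w := b - a); set (h := d - c).
assert (Hw : 0 <= w) by (unfold w; lra); assert (Hh : 0 <= h) by (unfold h; lra).
set (q := corner u v w h (a, c)).
set (X := fun k => fst (q k)); set (Y := fun k => snd (q k)).
assert (step : forall k, X k <= X (S k) <= X k + w / 2 ^ k / 2 /\ Y k <= Y (S k) <= Y k + h / 2 ^ k / 2).
{ intros k; unfold X, Y, q; simpl corner; destruct (corner u v w h (a, c) k) as [x y].
  apply bisect_corner; apply div_pow2_pos; assumption. }
assert (incX : forall k j, X k <= X (k + j)%nat /\ X (k + j)%nat + w / 2 ^ (k + j) <= X k + w / 2 ^ k
   /\ Y k <= Y (k + j)%nat /\ Y (k + j)%nat + h / 2 ^ (k + j) <= Y k + h / 2 ^ k).
{ intros k j; induction j as [|j IH]; [rewrite Nat.add_0_r; lra|].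
  rewrite Nat.add_succ_r, !div_pow2_S. pose proof (step (k + j)%nat). lra. }
assert (in0 : forall k, a <= X k /\ X k + w / 2 ^ k <= b /\ c <= Y k /\ Y k + h / 2 ^ k <= d).
{ intros k; pose proof (incX O k) as I; simpl Nat.add in I.
  assert (E1 : X O = a) by reflexivity; assert (E2 : Y O = c) by reflexivity.
  rewrite E1, E2, pow_O, !Rdiv_1_r in I. unfold w, h in *; lra. }
assert (big : forall k, Rabs (flux u v a b c d) / 4 ^ k
   <= Rabs (flux u v (X k) (X k + w / 2 ^ k) (Y k) (Y k + h / 2 ^ k))).
{ induction k as [|k IH].
  - rewrite !pow_O, !Rdiv_1_r.
    replace (X O) with a by reflexivity; replace (Y O) with c by reflexivity.
    replace (a + w) with b by (unfold w; ring); replace (c + h) with d by (unfold h; ring).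
    apply Rle_refl.
  - rewrite !div_pow2_S.
    apply Rle_trans with (Rabs (flux u v (X k) (X k + w / 2 ^ k) (Y k) (Y k + h / 2 ^ k)) / 4).
    + apply Rle_trans with (Rabs (flux u v a b c d) / 4 ^ k / 4); [right; simpl; field; apply pow_nonzero; lra|lra].
    + pose proof (in0 k) as I0.
      pose proof (div_pow2_pos w k Hw); pose proof (div_pow2_pos h k Hh).
      unfold X, Y, q in *; simpl corner; destruct (corner u v w h (a, c) k) as [x y]; simpl fst in *; simpl snd in *.
      apply bisect_flux; auto; intros s t Hs Ht; [apply Cu|apply Cv]; lra. }
destruct (ex_finite_lim_seq_incr X (b)) as [x Hx];
  [intros k; apply step | intros k; pose proof (in0 k); pose proof (div_pow2_pos w k Hw); lra|].
destruct (ex_finite_lim_seq_incr Y (d)) as [y Hy];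
  [intros k; apply step | intros k; pose proof (in0 k); pose proof (div_pow2_pos h k Hh); lra|].
assert (inx : forall k, X k <= x <= X k + w / 2 ^ k).
{ intros k; split.
  - apply (is_lim_seq_le_loc (fun _ => X k) X (X k) x); auto using is_lim_seq_const.
    exists k; intros j Hj; replace j with (k + (j - k))%nat by lia; apply incX.
  - apply (is_lim_seq_le_loc X (fun _ => X k + w / 2 ^ k) x (X k + w / 2 ^ k)); auto using is_lim_seq_const.
    exists k; intros j Hj; replace j with (k + (j - k))%nat by lia.
    pose proof (incX k (j - k)%nat); pose proof (div_pow2_pos w (k + (j - k)) Hw); lra. }
assert (iny : forall k, Y k <= y <= Y k + h / 2 ^ k).
{ intros k; split.
  - apply (is_lim_seq_le_loc (fun _ => Y k) Y (Y k) y); auto using is_lim_seq_const.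
    exists k; intros j Hj; replace j with (k + (j - k))%nat by lia; apply incX.
  - apply (is_lim_seq_le_loc Y (fun _ => Y k + h / 2 ^ k) y (Y k + h / 2 ^ k)); auto using is_lim_seq_const.
    exists k; intros j Hj; replace j with (k + (j - k))%nat by lia.
    pose proof (incX k (j - k)%nat); pose proof (div_pow2_pos h (k + (j - k)) Hh); lra. }
set (M := Rmax w h).
assert (HM : 0 <= M) by (unfold M; eapply Rle_trans; [exact Hw|apply Rmax_l]).
(* At stage k the sides are at most M / 2 ^ k, so the local bound is 4 * eps * M ^ 2 / 4 ^ k, and 4
   ^ k cancels against [big]. *)
assert (small : forall eps, 0 < eps -> Rabs (flux u v a b c d) <= 4 * eps * M ^ 2).
{ intros eps Heps.
  destruct (flux_local_bound u v x y eps) as (delta & Hd & B); auto.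
  { apply H; [pose proof (inx O) as I|pose proof (iny O) as I]; pose proof (in0 O); simpl pow in *; unfold w, h in *; lra. }
  (* The denominator is M + 1 because a degenerate rectangle has M = 0. *)
  destruct (pow_lt_1_zero (1 / 2) ltac:(rewrite Rabs_pos_eq; lra) (delta / (M + 1)) ltac:(apply Rdiv_lt_0_compat; lra)) as [k Hk].
  specialize (Hk k (Nat.le_refl k)).
  rewrite Rabs_pos_eq in Hk by (apply pow_le; lra).
  unfold Rdiv at 1 in Hk; rewrite Rmult_1_l, pow_inv in Hk.
  pose proof (pow2_pos k) as P2.
  assert (Hdk : M / 2 ^ k < delta).
  { apply (Rmult_lt_compat_r (M + 1)) in Hk; [|lra].
    replace (delta / (M + 1) * (M + 1)) with delta in Hk by (field; lra).
    apply Rle_lt_trans with (2 := Hk).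
    assert (0 < / 2 ^ k) by (apply Rinv_0_lt_compat; lra). unfold Rdiv; lra. }
  specialize (big k).
  pose proof (in0 k) as I0.
  pose proof (div_pow2_pos w k Hw); pose proof (div_pow2_pos h k Hh).
  assert (iv : 0 < / 2 ^ k) by (apply Rinv_0_lt_compat; lra).
  assert (w / 2 ^ k <= M / 2 ^ k) by (apply Rmult_le_compat_r; [lra|apply Rmax_l]).
  assert (h / 2 ^ k <= M / 2 ^ k) by (apply Rmult_le_compat_r; [lra|apply Rmax_r]).
  assert (B' := B (X k) (X k + w / 2 ^ k) (Y k) (Y k + h / 2 ^ k) (M / 2 ^ k)
    (inx k) (iny k) ltac:(lra) ltac:(lra) Hdk
    ltac:(intros s t Hs Ht; apply Cu; lra) ltac:(intros s t Hs Ht; apply Cv; lra)).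
  pose proof (Rle_trans _ _ _ big B') as L.
  assert (P4 : 4 ^ k = 2 ^ k * 2 ^ k) by (rewrite <- Rpow_mult_distr; f_equal; lra).
  rewrite P4 in L.
  apply (Rmult_le_compat_r (2 ^ k * 2 ^ k)) in L; [|apply Rmult_le_pos; lra].
  replace (Rabs (flux u v a b c d) / (2 ^ k * 2 ^ k) * (2 ^ k * 2 ^ k)) with (Rabs (flux u v a b c d)) in L by (field; lra).
  replace (4 * eps * (M / 2 ^ k) ^ 2 * (2 ^ k * 2 ^ k)) with (4 * eps * M ^ 2) in L by (field; lra).
  exact L. }
destruct (Req_dec (flux u v a b c d) 0) as [E|E]; auto; exfalso.
apply Rabs_pos_lt in E.
assert (HM2 : 0 <= M ^ 2) by apply pow2_ge_0.
(* With this eps the bound is at most half of the flux itself. *)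
specialize (small (Rabs (flux u v a b c d) / (8 * (M ^ 2 + 1))) ltac:(apply Rdiv_lt_0_compat; lra)).
replace (4 * (Rabs (flux u v a b c d) / (8 * (M ^ 2 + 1))) * M ^ 2)
  with (Rabs (flux u v a b c d) * (M ^ 2 / (M ^ 2 + 1)) / 2) in small by (field; lra).
assert (M ^ 2 / (M ^ 2 + 1) <= 1).
{ apply (Rmult_le_reg_r (M ^ 2 + 1)); [lra|]. unfold Rdiv; rewrite Rmult_assoc, Rinv_l; lra. }
nra.
Qed.

(** * Complex derivatives and the mean value property *)


(* Coquelicot has two uniform structures on C, by Cmod balls and as a product; here domain and
   codomain both carry the former, so that the generic derivation rules over an [AbsRing] apply.
   *)
Definition cdiff (f : C -> C) (z : C) : Prop :=
  ex_derive (K := C_AbsRing) (V := AbsRing_NormedModule C_AbsRing) f z.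

Definition ccont (f : C -> C) (z : C) : Prop :=
  forall eps : R, 0 < eps -> exists delta : R, 0 < delta /\
    forall w : C, Cmod (w - z) < delta -> Cmod (f w - f z) < eps.

Definition has_cderiv (f : C -> C) (z l : C) : Prop :=
  forall eps : R, 0 < eps -> exists delta : R, 0 < delta /\
    forall w : C, Cmod (w - z) < delta ->
      Cmod (f w - f z - (w - z) * l) <= eps * Cmod (w - z).

Lemma is_filter_lim_locally_C (z x : C) :
  is_filter_lim (T := AbsRing_UniformSpace C_AbsRing)
    (locally (T := AbsRing_UniformSpace C_AbsRing) z) x -> z = x.
Proof.
intros H; exact (is_filter_lim_locally_unique (K := C_AbsRing) (V := AbsRing_NormedModule C_AbsRing) z x H).
Qed.

Lemma cdiffP (f : C -> C) (z : C) : cdiff f z <-> exists l, has_cderiv f z l.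
Proof.
split; intros [l H]; exists l.
- destruct H as [_ H]; intros eps Heps.
  destruct (H z (fun P HP => HP) (mkposreal eps Heps)) as [d Hd].
  exists d; split; [apply cond_pos|]; intros w Hw; exact (Hd w Hw).
- split; [exact (is_linear_scal_l (V := AbsRing_NormedModule C_AbsRing) l)|].
  intros x Hx eps; apply is_filter_lim_locally_C in Hx; subst x.
  destruct (H eps (cond_pos eps)) as (d & Hd & B).
  exists (mkposreal d Hd); intros w Hw; exact (B w Hw).
Qed.

Lemma cdiff_ex_derive (f : C -> C) (z : C) :
  ex_derive (K := C_AbsRing) (V := C_NormedModule) f z -> cdiff f z.
Proof.
intros [l [_ H]]; apply cdiffP; exists l; intros eps Heps.
destruct (H z (fun P HP => HP) (mkposreal eps Heps)) as [d Hd].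
exists d; split; [apply cond_pos|]; intros w Hw; exact (Hd w Hw).
Qed.

Lemma cdiff_const (c z : C) : cdiff (fun _ => c) z.
Proof. exact (ex_derive_const (K := C_AbsRing) (V := AbsRing_NormedModule C_AbsRing) c z). Qed.

Lemma cdiff_id (z : C) : cdiff (fun w => w) z.
Proof. exact (ex_derive_id (K := C_AbsRing) z). Qed.

Lemma cdiff_plus (f g : C -> C) (z : C) :
  cdiff f z -> cdiff g z -> cdiff (fun w => f w + g w)%C z.
Proof. exact (ex_derive_plus (K := C_AbsRing) (V := AbsRing_NormedModule C_AbsRing) f g z). Qed.

Lemma cdiff_minus (f g : C -> C) (z : C) :
  cdiff f z -> cdiff g z -> cdiff (fun w => f w - g w)%C z.
Proof. exact (ex_derive_minus (K := C_AbsRing) (V := AbsRing_NormedModule C_AbsRing) f g z). Qed.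

Lemma cdiff_mult (f g : C -> C) (z : C) :
  cdiff f z -> cdiff g z -> cdiff (fun w => f w * g w)%C z.
Proof.
intros [lf Hf] [lg Hg]; eexists.
exact (is_derive_mult (K := C_AbsRing) f g z lf lg Hf Hg Cmult_comm).
Qed.

Lemma cdiff_comp (f g : C -> C) (z : C) :
  cdiff f (g z) -> cdiff g z -> cdiff (fun w => f (g w)) z.
Proof. exact (ex_derive_comp (K := C_AbsRing) (V := AbsRing_NormedModule C_AbsRing) f g z). Qed.

Lemma cdiff_ext_loc (f g : C -> C) (z : C) (r : R) :
  0 < r -> (forall w, Cmod (w - z) < r -> f w = g w) -> cdiff f z -> cdiff g z.
Proof.
intros Hr H; apply (ex_derive_ext_loc (K := C_AbsRing) (V := AbsRing_NormedModule C_AbsRing) f g z).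
exists (mkposreal r Hr); intros w Hw; exact (H w Hw).
Qed.

Lemma Cmod_triangle_rev (x y : C) : Cmod x - Cmod (y - x) <= Cmod y.
Proof.
pose proof (Cmod_triangle y (- (y - x))) as H.
replace (y + - (y - x))%C with x in H by ring. rewrite Cmod_opp in H. lra.
Qed.

Lemma cdiff_inv (z : C) : z <> 0%C -> cdiff Cinv z.
Proof.
intros Hz; apply cdiffP; exists (- / (z * z))%C; intros eps Heps.
assert (Pz : 0 < Cmod z) by (apply Cmod_gt_0; exact Hz).
(* The first bound keeps |w| above |z| / 2; the second then makes the remainder (w - z)^2 / (w z^2)
   at most eps |w - z|. *)
exists (Rmin (Cmod z / 2) (eps * Cmod z ^ 3 / 2)); split.
{ apply Rmin_pos; [lra|]. apply Rmult_lt_0_compat; [|lra].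
  apply Rmult_lt_0_compat; [lra|apply pow_lt; lra]. }
intros w Hw.
assert (H1 : Cmod (w - z) < Cmod z / 2) by (eapply Rlt_le_trans; [exact Hw|apply Rmin_l]).
assert (H2 : Cmod (w - z) < eps * Cmod z ^ 3 / 2) by (eapply Rlt_le_trans; [exact Hw|apply Rmin_r]).
pose proof (Cmod_triangle_rev z w) as H3.
assert (Pw : 0 < Cmod w) by lra.
assert (Hw0 : w <> 0%C) by (apply Cmod_gt_0; exact Pw).
replace (/ w - / z - (w - z) * - / (z * z))%C with ((w - z) * ((w - z) * / (w * (z * z))))%C
  by (field; split; assumption).
rewrite Cmod_mult, Rmult_comm; apply Rmult_le_compat_r; [apply Cmod_ge_0|].
rewrite Cmod_mult, Cmod_inv by (repeat apply Cmult_neq_0; assumption).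
rewrite !Cmod_mult.
assert (P3 : 0 < Cmod w * (Cmod z * Cmod z)) by (repeat apply Rmult_lt_0_compat; lra).
apply (Rmult_le_reg_r (Cmod w * (Cmod z * Cmod z))); auto.
rewrite Rmult_assoc, Rinv_l by lra; rewrite Rmult_1_r.
apply Rle_trans with (eps * (Cmod z / 2 * (Cmod z * Cmod z))); [lra|].
apply Rmult_le_compat_l; [lra|]; apply Rmult_le_compat_r; [|lra].
apply Rmult_le_pos; lra.
Qed.

Lemma cdiff_div (f g : C -> C) (z : C) :
  cdiff f z -> cdiff g z -> g z <> 0%C -> cdiff (fun w => f w / g w)%C z.
Proof.
intros Hf Hg Hz; apply cdiff_mult; auto.
apply (cdiff_comp Cinv g); auto; apply cdiff_inv; exact Hz.
Qed.

Lemma cdiff_ccont (f : C -> C) (z : C) : cdiff f z -> ccont f z.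
Proof.
intros H; apply cdiffP in H; destruct H as [l H]; intros eps Heps.
destruct (H 1 Rlt_0_1) as (d & Hd & B).
set (M := 1 + Cmod l); assert (HM : 0 < M) by (unfold M; pose proof (Cmod_ge_0 l); lra).
exists (Rmin d (eps / M)); split; [apply Rmin_pos; [exact Hd|apply Rdiv_lt_0_compat; lra]|].
intros w Hw.
specialize (B w (Rlt_le_trans _ _ _ Hw (Rmin_l _ _))).
assert (H2 : Cmod (w - z) < eps / M) by (eapply Rlt_le_trans; [exact Hw|apply Rmin_r]).
apply (Rmult_lt_compat_r M) in H2; auto.
replace (eps / M * M) with eps in H2 by (field; lra).
pose proof (Cmod_triangle (f w - f z - (w - z) * l) ((w - z) * l)) as T.
replace (f w - f z - (w - z) * l + (w - z) * l)%C with (f w - f z)%C in T by ring.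
rewrite Cmod_mult in T; unfold M in H2; lra.
Qed.

Lemma Rabs_Im_le (z : C) : Rabs (Im z) <= Cmod z.
Proof. eapply Rle_trans; [apply Rmax_r|apply Rmax_Cmod]. Qed.

Lemma Cmod_le_2Rmax (z : C) : Cmod z <= 2 * Rmax (Rabs (Re z)) (Rabs (Im z)).
Proof.
eapply Rle_trans; [apply Cmod_2Rmax|]; apply Rmult_le_compat_r.
- eapply Rle_trans; [apply Rabs_pos|apply Rmax_l].
- rewrite <- (sqrt_square 2) at 2 by lra; apply sqrt_le_1; lra.
Qed.

Lemma differentiable_Re_Im (k : C -> C) (x y : R) :
  cdiff k (x, y) -> exists p q : R,
    differentiable_pt_lim (fun x y => Re (k (x, y))) x y p (- q) /\
    differentiable_pt_lim (fun x y => Im (k (x, y))) x y q p.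
Proof.
intros H; apply cdiffP in H; destruct H as [l H]; exists (Re l), (Im l).
(* Half of eps, because [Cmod] can be up to twice the max norm used by [differentiable_pt_lim], by
   the crude bound [Cmod_le_2Rmax]. *)
split; intros eps; (destruct (H (eps / 2)) as (d & Hd & B); [pose proof (cond_pos eps); lra|]);
  exists (mkposreal (d / 2) ltac:(lra)); intros u v Hu Hv; simpl in Hu, Hv;
  pose proof (Cmod_le_2Rmax ((u, v) - (x, y))%C) as N;
  (assert (S : Cmod ((u, v) - (x, y)) < d);
    [eapply Rle_lt_trans; [exact N|];
     enough (Rmax (Rabs (Re ((u, v) - (x, y))%C)) (Rabs (Im ((u, v) - (x, y))%C)) < d / 2) by lra;
     apply Rmax_lub_lt; assumption|]);
  specialize (B (u, v) S);
  change (Re ((u, v) - (x, y))%C) with (u - x) in N;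
  change (Im ((u, v) - (x, y))%C) with (v - y) in N;
  (apply Rle_trans with (eps / 2 * Cmod ((u, v) - (x, y)));
    [eapply Rle_trans; [|exact B]
    |pose proof (cond_pos eps);
     apply Rle_trans with (eps / 2 * (2 * Rmax (Rabs (u - x)) (Rabs (v - y)))); [apply Rmult_le_compat_l; lra|lra]]).
- eapply Rle_trans; [|apply re_le_Cmod]; right; f_equal.
  destruct l as [l1 l2]; destruct (k (u, v)), (k (x, y)); simpl; ring.
- eapply Rle_trans; [|apply Rabs_Im_le]; right; f_equal.
  destruct l as [l1 l2]; destruct (k (u, v)), (k (x, y)); simpl; ring.
Qed.

(** * Polar coordinates and circle integrals *)

Definition polar (s th : R) : C := (exp s * cos th, exp s * sin th).

Lemma differentiable_polar (s th : R) :
  differentiable_pt_lim (fun s th => exp s * cos th) s th (exp s * cos th) (- (exp s * sin th)) /\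
  differentiable_pt_lim (fun s th => exp s * sin th) s th (exp s * sin th) (exp s * cos th).
Proof.
assert (M : forall x y, differentiable_pt_lim Rmult x y y x).
{ intros x y eps; exists eps; intros u v Hu Hv.
  replace (u * v - x * y - (y * (u - x) + x * (v - y))) with ((u - x) * (v - y)) by ring.
  rewrite Rabs_mult; apply Rmult_le_compat; try apply Rabs_pos; [lra|apply Rmax_r]. }
assert (E : differentiable_pt_lim (fun s _ => exp s) s th (exp s) 0)
  by (apply differentiable_pt_lim_proj1_0, derivable_pt_lim_exp).
assert (P2 : forall f l, derivable_pt_lim f th l -> differentiable_pt_lim (fun _ t => f t) s th 0 l).
{ intros f l Hf eps.
  destruct (differentiable_pt_lim_proj1_0 f th s l Hf eps) as [d Hd].
  exists d; intros u v Hu Hv; specialize (Hd v u Hv Hu).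
  rewrite Rmax_comm; eapply Rle_trans; [right|exact Hd]; f_equal; ring. }
split.
- replace (exp s * cos th) with (cos th * exp s + exp s * 0) at 1 by ring.
  replace (- (exp s * sin th)) with (cos th * 0 + exp s * (- sin th)) by ring.
  apply (differentiable_pt_lim_comp Rmult (fun s _ => exp s) (fun _ t => cos t)); auto.
  apply P2, derivable_pt_lim_cos.
- replace (exp s * sin th) with (sin th * exp s + exp s * 0) at 1 by ring.
  replace (exp s * cos th) with (sin th * 0 + exp s * cos th) by ring.
  apply (differentiable_pt_lim_comp Rmult (fun s _ => exp s) (fun _ t => sin t)); auto.
  apply P2, derivable_pt_lim_sin.
Qed.

(* The Cauchy-Riemann equation for k(e^(s+i th)). *)
Lemma polar_divergence_free (k : C -> C) (s th : R) :
  cdiff k (polar s th) ->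
  divergence_free_at (fun s th => Re (k (polar s th))) (fun s th => Im (k (polar s th))) s th.
Proof.
intros H; apply differentiable_Re_Im in H; destruct H as (p & q & Hu & Hv).
destruct (differentiable_polar s th) as [Dc Ds].
pose proof (differentiable_pt_lim_comp _ _ _ _ _ _ _ _ _ _ _ Hu Dc Ds) as Du.
pose proof (differentiable_pt_lim_comp _ _ _ _ _ _ _ _ _ _ _ Hv Dc Ds) as Dv.
eexists _, _, _; split; [exact Du|].
replace (p * (exp s * cos th) + - q * (exp s * sin th))
  with (q * - (exp s * sin th) + p * (exp s * cos th)) by ring.
exact Dv.
Qed.

Lemma Cmod_polar (s th : R) : Cmod (polar s th) = exp s.
Proof.
unfold Cmod, polar; simpl.
replace (exp s * cos th * (exp s * cos th * 1) + exp s * sin th * (exp s * sin th * 1))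
  with (exp s * exp s * (Rsqr (sin th) + Rsqr (cos th))) by (unfold Rsqr; ring).
rewrite sin2_cos2, Rmult_1_r; apply sqrt_square, Rlt_le, exp_pos.
Qed.

Lemma polar_continuity (k : C -> C) (s th : R) :
  ccont k (polar s th) -> continuity_2d_pt (fun s th => Re (k (polar s th))) s th.
Proof.
intros H eps.
destruct (H eps (cond_pos eps)) as (d & Hd & B).
destruct (differentiable_polar s th) as [Dc Ds].
assert (Cc := differentiable_continuity_pt _ _ _ (ex_intro _ _ (ex_intro _ _ Dc))).
assert (Cs := differentiable_continuity_pt _ _ _ (ex_intro _ _ (ex_intro _ _ Ds))).
destruct (Cc (mkposreal (d / 2) ltac:(lra))) as [d1 H1].
destruct (Cs (mkposreal (d / 2) ltac:(lra))) as [d2 H2].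
exists (mkposreal (Rmin d1 d2) ltac:(apply Rmin_pos; apply cond_pos)); simpl.
intros u v Hu Hv.
eapply Rle_lt_trans; [apply (re_le_Cmod (k (polar u v) - k (polar s th)))|]; apply B.
eapply Rle_lt_trans; [apply Cmod_le_2Rmax|].
enough (Rmax (Rabs (Re (polar u v - polar s th)%C)) (Rabs (Im (polar u v - polar s th)%C)) < d / 2) by lra.
apply Rmax_lub_lt; [apply H1|apply H2];
  (eapply Rlt_le_trans; [eassumption|]); (apply Rmin_l || apply Rmin_r).
Qed.

Lemma exp_le (x y : R) : x <= y -> exp x <= exp y.
Proof. intros [H|H]; [apply Rlt_le, exp_increasing, H|subst; apply Rle_refl]. Qed.

Lemma polar_2PI (s : R) : polar s (2 * PI) = polar s 0.
Proof. unfold polar; rewrite cos_2PI, sin_2PI, cos_0, sin_0; reflexivity. Qed.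

(** [s] is the logarithm of the radius. Real parts are enough, since a unimodular factor can make
    any chosen value of [k] real. *)
Definition circle_integral (k : C -> C) (s : R) : R :=
  RInt (fun th => Re (k (polar s th))) 0 (2 * PI).

(** The sides th = 0 and th = 2 pi of the rectangle carry equal values by periodicity and cancel, so
    the flux is the difference of the two circle integrals. *)
Lemma circle_integral_const (k : C -> C) (s0 s1 : R) :
  s0 <= s1 -> (forall t, exp s0 <= Cmod t <= exp s1 -> cdiff k t) ->
  circle_integral k s0 = circle_integral k s1.
Proof.
intros Hs H; pose proof PI_RGT_0.
assert (F := flux_zero (fun s th => Re (k (polar s th))) (fun s th => Im (k (polar s th)))
  s0 s1 0 (2 * PI) Hs ltac:(lra)).
unfold flux in F; cbv beta in F.
rewrite (RInt_ext (fun x => Im (k (polar x (2 * PI)))) (fun x => Im (k (polar x 0)))) in F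
  by (intros x _; rewrite polar_2PI; reflexivity).
enough (E : forall x y, s0 <= x <= s1 -> 0 <= y <= 2 * PI -> divergence_free_at
  (fun s th => Re (k (polar s th))) (fun s th => Im (k (polar s th))) x y)
  by (specialize (F E); unfold circle_integral; simpl in *; lra).
intros x y Hx _; apply polar_divergence_free, H; rewrite Cmod_polar.
split; apply exp_le; lra.
Qed.

Lemma ex_RInt_circle (k : C -> C) (s : R) :
  (forall t, Cmod t = exp s -> ccont k t) ->
  ex_RInt (fun th => Re (k (polar s th))) 0 (2 * PI).
Proof.
intros H; apply (ex_RInt_continuous (V := R_CompleteNormedModule)); intros th _.
apply (continuity_2d_pt_slice_l (fun s th => Re (k (polar s th)))), polar_continuity, H, Cmod_polar.
Qed.

Lemma circle_integral_close (k : C -> C) (s : R) (K : C -> C) (s' eps : R) :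
  (forall t, Cmod t = exp s -> ccont k t) -> (forall t, Cmod t = exp s' -> ccont K t) ->
  (forall th, 0 <= th <= 2 * PI -> Rabs (Re (k (polar s th)) - Re (K (polar s' th))) <= eps) ->
  Rabs (circle_integral k s - circle_integral K s') <= 2 * PI * eps.
Proof.
intros Hk HK H; pose proof PI_RGT_0.
pose proof (RInt_increment (fun th => Re (k (polar s th))) (fun th => Re (K (polar s' th))) 0 0 (2 * PI) eps
  ltac:(lra) (ex_RInt_circle k s Hk) (ex_RInt_circle K s' HK)) as I.
unfold circle_integral; rewrite Rmult_0_l, !Rminus_0_r in I; apply I.
intros x Hx; rewrite Rminus_0_r; auto.
Qed.

Lemma ccont_const (c z : C) : ccont (fun _ => c) z.
Proof. apply cdiff_ccont, cdiff_const. Qed.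

Lemma Rabs_le_eps_eq (x y M : R) :
  (forall eps, 0 < eps -> Rabs (x - y) <= M * eps) -> x = y.
Proof.
intros H; destruct (Req_dec x y) as [|N]; auto; exfalso.
assert (P : 0 < Rabs (x - y)) by (apply Rabs_pos_lt; lra).
destruct (Rle_dec M 0) as [HM|HM]; [specialize (H 1 Rlt_0_1); lra|].
specialize (H (Rabs (x - y) / (2 * M)) ltac:(apply Rdiv_lt_0_compat; lra)).
replace (M * (Rabs (x - y) / (2 * M))) with (Rabs (x - y) / 2) in H by (field; lra); lra.
Qed.

(* Continuity suffices at the exceptional point e: the circle integral is constant on either side
   of |e|, and continuous in the radius. *)
Lemma mean_value (k : C -> C) (e : C) (rho : R) :
  0 < Cmod e < rho ->
  (forall t, Cmod t <= rho -> ccont k t) ->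
  (forall t, Cmod t <= rho -> t <> e -> cdiff k t) ->
  circle_integral k (ln rho) = 2 * PI * Re (k 0%C).
Proof.
intros He Hc Hd; pose proof PI_RGT_0.
set (se := ln (Cmod e)); set (sr := ln rho).
assert (Ee : exp se = Cmod e) by (apply exp_ln; lra).
assert (Er : exp sr = rho) by (apply exp_ln; lra).
assert (Hes : se < sr) by (apply ln_increasing; lra).
assert (I0 : forall s, s < se -> circle_integral k s = 2 * PI * Re (k 0%C)).
{ intros s Hs; apply (Rabs_le_eps_eq _ _ (2 * PI)); intros eps Heps.
  destruct (Hc 0%C ltac:(rewrite Cmod_0; lra) eps Heps) as (d & Hd0 & B).
  (* A circle inside the given one on which [k] is within eps of its value at 0. *)
  set (s' := Rmin s (ln (d / 2))).
  assert (Es' : exp s' < d).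
  { apply Rle_lt_trans with (exp (ln (d / 2))); [apply exp_le, Rmin_r|rewrite exp_ln; lra]. }
  assert (Hs' : s' <= s) by apply Rmin_l.
  assert (Ecc : circle_integral k s' = circle_integral k s).
  { apply circle_integral_const; [exact Hs'|]; intros t [_ Ht]; apply Hd.
    - apply Rle_trans with (1 := Ht); rewrite <- Er; apply exp_le; lra.
    - intros E; subst t; apply exp_increasing in Hs; lra. }
  rewrite <- Ecc.
  replace (2 * PI * Re (k 0%C)) with (circle_integral (fun _ => k 0%C) s').
  2: { unfold circle_integral; rewrite RInt_const; unfold scal; simpl; unfold mult; simpl; ring. }
  apply circle_integral_close; [|intros; apply ccont_const|].
  - intros t Ht; apply Hc; rewrite Ht, <- Er; apply exp_le; lra.
  - intros th _. apply Rlt_le.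
    eapply Rle_lt_trans; [apply (re_le_Cmod (k (polar s' th) - k 0%C))|]; apply B.
    replace (polar s' th - 0)%C with (polar s' th) by ring; rewrite Cmod_polar; exact Es'. }
assert (I1 : forall s, se < s <= sr -> circle_integral k s = circle_integral k sr).
{ intros s Hs; apply circle_integral_const; [lra|]; intros t [Ht1 Ht2]; apply Hd; [lra|].
  intros E; subst t; destruct Hs as [Hs _]; apply exp_increasing in Hs; lra. }
apply (Rabs_le_eps_eq _ _ (2 * PI)); intros eps Heps.
destruct (uniform_continuity_2d (fun s th => Re (k (polar s th))) (se - 1) sr 0 (2 * PI)) with (eps := mkposreal eps Heps) as [d B].
{ intros s th Hs _; apply polar_continuity, Hc; rewrite Cmod_polar, <- Er; apply exp_le; lra. }
pose proof (cond_pos d) as Pd.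
(* The circles at se - h and se + h straddle the exceptional radius: 2h < d for uniform continuity,
   se + h <= sr, and se - h stays in the compact range starting at se - 1. *)
set (h := Rmin (d / 3) (Rmin (sr - se) 1)).
assert (h1 : h <= d / 3) by apply Rmin_l.
assert (h2 : h <= sr - se) by (eapply Rle_trans; [apply Rmin_r|apply Rmin_l]).
assert (h3 : h <= 1) by (eapply Rle_trans; [apply Rmin_r|apply Rmin_r]).
assert (h0 : 0 < h) by (unfold h; repeat apply Rmin_pos; lra).
rewrite <- (I0 (se - h)) by lra; rewrite <- (I1 (se + h)) by lra.
apply circle_integral_close.
- intros t Ht; apply Hc; rewrite Ht, <- Er; apply exp_le; lra.
- intros t Ht; apply Hc; rewrite Ht, <- Er; apply exp_le; lra.
- intros th Hth; apply Rlt_le; apply (B (se - h) th (se + h) th); try lra;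
    [apply Rabs_lt_between; lra|rewrite Rminus_diag, Rabs_R0; lra].
Qed.

(** * The Schwarz lemma and the maximum principle *)


Lemma RtoC_neq_0 (x : R) : x <> 0 -> RtoC x <> 0%C.
Proof. intros H E; apply H; exact (f_equal fst E). Qed.

(** Two uses share this form: [v] turns the value at the centre into a positive real, and [u] turns
    a chosen boundary point to a fixed angle. *)
Lemma ccont_rotation (k : C -> C) (u z v : C) :
  Cmod u = 1 -> Cmod v = 1 -> ccont k (u * z)%C -> ccont (fun w => v * k (u * w))%C z.
Proof.
intros Hu Hv H eps Heps; destruct (H eps Heps) as (d & Hd & B); exists d; split; [exact Hd|].
intros w Hw.
replace (v * k (u * w) - v * k (u * z))%C with (v * (k (u * w) - k (u * z)))%C by ring.
rewrite Cmod_mult, Hv, Rmult_1_l; apply B.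
replace (u * w - u * z)%C with (u * (w - z))%C by ring.
rewrite Cmod_mult, Hu, Rmult_1_l; exact Hw.
Qed.

Lemma cdiff_rotation (k : C -> C) (u z v : C) :
  cdiff k (u * z)%C -> cdiff (fun w => v * k (u * w))%C z.
Proof.
intros H; apply cdiff_mult; [apply cdiff_const|].
apply (cdiff_comp k (fun w => u * w)%C); [exact H|].
apply cdiff_mult; [apply cdiff_const|apply cdiff_id].
Qed.

(** Once [v] makes the central value equal to its modulus, that modulus is an average of real parts,
    each at most M. *)
Lemma Cmod_0_center (k : C -> C) (e : C) (rho M : R) :
  0 < Cmod e < rho ->
  (forall t, Cmod t <= rho -> ccont k t) ->
  (forall t, Cmod t <= rho -> t <> e -> cdiff k t) ->
  (forall t, Cmod t = rho -> Cmod (k t) <= M) ->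
  Cmod (k 0%C) <= M.
Proof.
intros He Hc Hd HM; pose proof PI_RGT_0.
assert (M0 : 0 <= M).
{ eapply Rle_trans; [apply Cmod_ge_0|apply (HM rho); rewrite Cmod_R; apply Rabs_pos_eq; lra]. }
destruct (Ceq_dec (k 0%C) 0%C) as [E|E]; [rewrite E, Cmod_0; exact M0|].
assert (P : 0 < Cmod (k 0%C)) by (apply Cmod_gt_0; exact E).
set (v := (Cconj (k 0%C) / Cmod (k 0%C))%C).
assert (N : RtoC (Cmod (k 0%C)) <> 0%C) by (apply RtoC_neq_0; lra).
assert (Hv : Cmod v = 1).
{ unfold v; rewrite Cmod_div, Cmod_conj, Cmod_R, Rabs_pos_eq by (auto; lra); field; lra. }
assert (E0 : (v * k (1 * 0))%C = RtoC (Cmod (k 0%C))).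
{ unfold v; rewrite Cmult_1_l.
  replace (Cconj (k 0) / Cmod (k 0) * k 0)%C with (k 0 * Cconj (k 0) / Cmod (k 0))%C by (field; exact N).
  rewrite <- Cmod2_conj.
  replace (RtoC (Cmod (k 0%C) ^ 2)) with (Cmod (k 0%C) * Cmod (k 0%C))%C
    by (rewrite <- RtoC_mult; f_equal; ring).
  field; exact N. }
assert (Er : exp (ln rho) = rho) by (apply exp_ln; lra).
assert (Hc' : forall t, Cmod t <= rho -> ccont (fun w => v * k (1 * w))%C t).
{ intros t Ht; apply ccont_rotation; auto using Cmod_1; rewrite Cmult_1_l; auto. }
assert (MV : circle_integral (fun w => v * k (1 * w))%C (ln rho) = 2 * PI * Cmod (k 0%C)).
{ rewrite (mean_value _ e rho He Hc'), E0; [reflexivity|].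
  intros t Ht Hte; apply cdiff_rotation; rewrite Cmult_1_l; auto. }
assert (B : Rabs (circle_integral (fun w => v * k (1 * w))%C (ln rho)) <= (2 * PI - 0) * M).
{ apply abs_RInt_le_const; [lra| |].
  - apply (ex_RInt_circle (fun w => v * k (1 * w))%C); intros t Ht; apply Hc'; lra.
  - intros th _; eapply Rle_trans; [apply re_le_Cmod|].
    rewrite Cmod_mult, Hv, Rmult_1_l, Cmult_1_l; apply HM; rewrite Cmod_polar; exact Er. }
rewrite MV in B; rewrite Rabs_pos_eq in B by (apply Rmult_le_pos; lra); nra.
Qed.

Lemma RInt_nonneg_zero (f : R -> R) (a b x : R) :
  a < x < b -> (forall y, a <= y <= b -> continuous f y) ->
  (forall y, a <= y <= b -> 0 <= f y) -> RInt f a b = 0 -> f x = 0.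
Proof.
intros Hx Hc Hp I0; destruct (Req_dec (f x) 0) as [|N]; auto; exfalso.
assert (P : 0 < f x) by (pose proof (Hp x ltac:(lra)); lra).
pose proof (Hc x ltac:(lra)) as Cx; apply continuity_pt_filterlim in Cx.
destruct (Cx (f x / 2) ltac:(lra)) as (d & Hd & B).
set (h := Rmin (d / 2) (Rmin (x - a) (b - x))).
assert (h1 : h <= d / 2) by apply Rmin_l.
assert (h2 : h <= x - a) by (eapply Rle_trans; [apply Rmin_r|apply Rmin_l]).
assert (h3 : h <= b - x) by (eapply Rle_trans; [apply Rmin_r|apply Rmin_r]).
assert (h0 : 0 < h) by (unfold h; repeat apply Rmin_pos; lra).
assert (EX : forall y z, a <= y -> y <= z -> z <= b -> ex_RInt f y z).
{ intros y z Hy Hyz Hz; apply (ex_RInt_continuous (V := R_CompleteNormedModule)).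
  intros w; rewrite Rmin_left, Rmax_right by lra; intros Hw; apply Hc; lra. }
assert (E1 : RInt f a b = RInt f a (x - h) + (RInt f (x - h) (x + h) + RInt f (x + h) b)).
{ symmetry; rewrite <- (RInt_Chasles f a (x - h) b) by (apply EX; lra).
  rewrite <- (RInt_Chasles f (x - h) (x + h) b) by (apply EX; lra); reflexivity. }
assert (I1 : 0 <= RInt f a (x - h)) by (apply RInt_ge_0; [lra|apply EX; lra|intros; apply Hp; lra]).
assert (I3 : 0 <= RInt f (x + h) b) by (apply RInt_ge_0; [lra|apply EX; lra|intros; apply Hp; lra]).
assert (I2 : RInt (fun _ => f x / 2) (x - h) (x + h) <= RInt f (x - h) (x + h)).
{ apply RInt_le; [lra|apply ex_RInt_const|apply EX; lra|].
  intros y Hy; destruct (Req_dec x y) as [->|Ny]; [lra|].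
  assert (D : Rabs (f y - f x) < f x / 2).
  { apply B; split; [split; [exact I|exact Ny]|]. apply (Rabs_lt_between (y - x)); lra. }
  apply Rabs_lt_between in D; lra. }
rewrite RInt_const in I2; unfold scal in I2; simpl in I2; unfold mult in I2; simpl in I2.
nra.
Qed.

Lemma eq_1_of_Re (z : C) : Cmod z <= 1 -> Re z = 1 -> z = 1%C.
Proof.
intros H1 H2; pose proof (Cmod2_alt z) as E.
pose proof (Cmod_ge_0 z) as H0.
destruct z as [x y]; simpl in *; subst x.
assert (y = 0) by nra. subst y; reflexivity.
Qed.

(** Equality case of the maximum principle: 1 - Re k is continuous and nonnegative on the circle
    with mean 0, so it vanishes, and with |k| <= 1 this forces k = 1. *)
Lemma extremal_on_circle (k : C -> C) (e : C) (rho : R) :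
  0 < Cmod e < rho ->
  (forall t, Cmod t <= rho -> ccont k t) ->
  (forall t, Cmod t <= rho -> t <> e -> cdiff k t) ->
  (forall t, Cmod t = rho -> Cmod (k t) <= 1) -> k 0%C = 1%C ->
  forall t, Cmod t = rho -> k t = 1%C.
Proof.
intros He Hc Hd HM H0 t Ht; pose proof PI_RGT_0.
assert (Hr : RtoC rho <> 0%C) by (apply RtoC_neq_0; lra).
assert (Ht0 : t <> 0%C) by (apply Cmod_gt_0; lra).
(* This rotation puts [t] at the angle pi, an interior point of [0, 2 pi] as [RInt_nonneg_zero]
   demands. *)
set (u := (- t / rho)%C).
assert (Hu : Cmod u = 1).
{ unfold u; rewrite Cmod_div, Cmod_opp, Cmod_R, Ht, Rabs_pos_eq by (auto; lra); field; lra. }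
assert (Hu0 : u <> 0%C) by (apply Cmod_gt_0; lra).
assert (Er : exp (ln rho) = rho) by (apply exp_ln; lra).
assert (Hc' : forall s, Cmod s <= rho -> ccont (fun w => 1 * k (u * w))%C s).
{ intros s Hs; apply ccont_rotation; auto using Cmod_1; apply Hc; rewrite Cmod_mult, Hu; lra. }
assert (MV : circle_integral (fun w => 1 * k (u * w))%C (ln rho) = 2 * PI).
{ rewrite (mean_value _ (e / u)%C); auto.
  - rewrite Cmult_0_r, H0; simpl; ring.
  - rewrite Cmod_div, Hu by exact Hu0; lra.
  - intros s Hs Hse; apply cdiff_rotation, Hd; [rewrite Cmod_mult, Hu; lra|].
    intros E; apply Hse; rewrite <- E; field; exact Hu0. }
assert (Hpi : polar (ln rho) PI = (- rho)%C).
{ unfold polar; rewrite Er, cos_PI, sin_PI; apply injective_projections; simpl; ring. }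
assert (Z : 1 - Re (1 * k (u * polar (ln rho) PI))%C = 0).
{ apply (RInt_nonneg_zero (fun th => 1 - Re (1 * k (u * polar (ln rho) th))%C) 0 (2 * PI)); [lra| | |].
  - intros th _; apply (continuous_minus (V := R_NormedModule)); [apply continuous_const|].
    apply (continuity_2d_pt_slice_l (fun s th => Re (1 * k (u * polar s th))%C)).
    apply (polar_continuity (fun w => 1 * k (u * w))%C); apply Hc'; rewrite Cmod_polar; lra.
  - intros th _.
    pose proof (re_le_Cmod (1 * k (u * polar (ln rho) th))%C) as B.
    rewrite Cmod_mult, Cmod_1, Rmult_1_l in B.
    assert (B2 : Cmod (k (u * polar (ln rho) th)%C) <= 1) by (apply HM; rewrite Cmod_mult, Hu, Cmod_polar; lra).
    apply Rabs_le_between in B; lra.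
  - rewrite (RInt_minus (V := R_CompleteNormedModule) (fun _ => 1)).
    + rewrite RInt_const; unfold circle_integral in MV; rewrite MV.
      unfold minus, plus, opp, scal; simpl; unfold mult; simpl; ring.
    + apply ex_RInt_const.
    + apply (ex_RInt_circle (fun w => 1 * k (u * w))%C); intros s Hs; apply Hc'; lra. }
rewrite Hpi, Cmult_1_l in Z.
replace (u * - rho)%C with t in Z by (unfold u; field; exact Hr).
apply eq_1_of_Re; [apply HM; exact Ht|lra].
Qed.

(** The value at [e] is the derivative of [Q] there, so continuity at [e] is convergence of the
    difference quotients. *)
Lemma removable_quotient (Q : C -> C) (e : C) (rho : R) :
  (forall t, Cmod t <= rho -> cdiff Q t) -> Cmod e <= rho -> Q e = 0%C ->
  exists k : C -> C,
    (forall t, t <> e -> k t = (Q t / (t - e))%C) /\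
    (forall t, Cmod t <= rho -> ccont k t) /\
    (forall t, Cmod t <= rho -> t <> e -> cdiff k t).
Proof.
intros HQ He Qe.
destruct (proj1 (cdiffP Q e) (HQ e He)) as [l Hl].
set (k := fun t => if Ceq_dec t e then l else (Q t / (t - e))%C).
assert (Hk : forall t, t <> e -> k t = (Q t / (t - e))%C).
{ intros t Ht; unfold k; destruct (Ceq_dec t e); [contradiction|reflexivity]. }
assert (Hsub : forall t, t <> e -> (t - e)%C <> 0%C).
{ intros t Ht E; apply Ht; replace t with ((t - e) + e)%C by ring; rewrite E; ring. }
assert (Hd : forall t, Cmod t <= rho -> t <> e -> cdiff k t).
{ intros t Ht Hte.
  apply (cdiff_ext_loc (fun t => Q t / (t - e))%C) with (r := Cmod (t - e)).
  - apply Cmod_gt_0; auto.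
  - intros w Hw; symmetry; apply Hk; intros E; subst w.
    replace (e - t)%C with (- (t - e))%C in Hw by ring; rewrite Cmod_opp in Hw; lra.
  - apply cdiff_div; auto. apply cdiff_minus; [apply cdiff_id|apply cdiff_const]. }
exists k; split; [exact Hk|split; [|exact Hd]].
intros t Ht; destruct (Ceq_dec t e) as [->|N]; [|apply cdiff_ccont; auto].
intros eps Heps; destruct (Hl (eps / 2) ltac:(lra)) as (d & Hd0 & B).
exists d; split; [exact Hd0|]; intros w Hw.
replace (k e) with l by (unfold k; destruct (Ceq_dec e e); [reflexivity|contradiction]).
destruct (Ceq_dec w e) as [->|Nw].
- replace (k e) with l by (unfold k; destruct (Ceq_dec e e); [reflexivity|contradiction]).
  unfold Cminus; rewrite Cplus_opp_r, Cmod_0; exact Heps.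
- rewrite Hk by exact Nw; specialize (B w Hw); rewrite Qe in B.
  replace (Q w / (w - e) - l)%C with ((Q w - 0 - (w - e) * l) / (w - e))%C by (field; auto).
  assert (P : 0 < Cmod (w - e)) by (apply Cmod_gt_0; auto).
  rewrite Cmod_div by auto.
  apply (Rmult_lt_reg_r (Cmod (w - e))); [exact P|].
  unfold Rdiv; rewrite Rmult_assoc, Rinv_l, Rmult_1_r by lra.
  apply Rle_lt_trans with (1 := B); apply Rmult_lt_compat_r; lra.
Qed.

(** * Automorphisms of the disk *)

Definition mobius (a z : C) : C := ((z - a) / (1 - Cconj a * z))%C.

Lemma mobius_den (a z : C) : Cmod a < 1 -> Cmod z <= 1 -> (1 - Cconj a * z)%C <> 0%C.
Proof.
intros Ha Hz E.
pose proof (Cmod_triangle_rev 1 (1 - (1 - Cconj a * z))%C) as T.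
rewrite E in T at 1; rewrite Cmod_1 in T.
replace (1 - 0 - 1)%C with (RtoC 0) in T by ring; rewrite Cmod_0 in T.
replace (1 - (1 - Cconj a * z))%C with (Cconj a * z)%C in T by ring.
rewrite Cmod_mult, Cmod_conj in T.
pose proof (Cmod_ge_0 a); pose proof (Cmod_ge_0 z); nra.
Qed.

(** The sign of the right side tells on which side of 1 the modulus of [mobius a z] lies: below it
    inside the disk, equal to it on the circle. *)
Lemma mobius_identity (a z : C) :
  Cmod (1 - Cconj a * z) ^ 2 - Cmod (z - a) ^ 2 = (1 - Cmod a ^ 2) * (1 - Cmod z ^ 2).
Proof. rewrite !Cmod2_alt; destruct a, z; simpl; ring. Qed.

Lemma Cmod_mobius (a z : C) : Cmod a < 1 -> Cmod z <= 1 ->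
  Cmod (mobius a z) * Cmod (1 - Cconj a * z) = Cmod (z - a).
Proof.
intros Ha Hz; rewrite <- Cmod_mult; unfold mobius; f_equal; field; apply mobius_den; auto.
Qed.

Lemma mobius_lt_1 (a z : C) : Cmod a < 1 -> Cmod z < 1 -> Cmod (mobius a z) < 1.
Proof.
intros Ha Hz; pose proof (Cmod_mobius a z Ha (Rlt_le _ _ Hz)) as E.
pose proof (mobius_identity a z) as I; rewrite <- E in I.
pose proof (Cmod_ge_0 a); pose proof (Cmod_ge_0 z); pose proof (Cmod_ge_0 (mobius a z)).
assert (0 < (1 - Cmod a ^ 2) * (1 - Cmod z ^ 2)) by (apply Rmult_lt_0_compat; nra).
assert (D : 0 < Cmod (1 - Cconj a * z)) by (apply Cmod_gt_0, mobius_den; lra).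
apply Rnot_le_lt; intros N.
assert (1 <= Cmod (mobius a z) ^ 2) by nra.
assert (0 < Cmod (1 - Cconj a * z) ^ 2) by nra.
nra.
Qed.

Lemma mobius_eq_1 (a z : C) : Cmod a < 1 -> Cmod z = 1 -> Cmod (mobius a z) = 1.
Proof.
intros Ha Hz; pose proof (Cmod_mobius a z Ha (Req_le _ _ Hz)) as E.
pose proof (mobius_identity a z) as I; rewrite <- E, Hz in I.
pose proof (Cmod_ge_0 (mobius a z)).
assert (D : 0 < Cmod (1 - Cconj a * z)) by (apply Cmod_gt_0, mobius_den; lra).
assert (0 < Cmod (1 - Cconj a * z) ^ 2) by nra.
assert (Cmod (mobius a z) ^ 2 = 1); nra.
Qed.

Lemma mobius_le_1 (a z : C) : Cmod a < 1 -> Cmod z <= 1 -> Cmod (mobius a z) <= 1.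
Proof.
intros Ha [Hz|Hz]; [apply Rlt_le, mobius_lt_1; auto|rewrite mobius_eq_1; auto; lra].
Qed.

Lemma cdiff_mobius (a z : C) : Cmod a < 1 -> Cmod z <= 1 -> cdiff (mobius a) z.
Proof.
intros Ha Hz; apply cdiff_div; [| |apply mobius_den; auto].
- apply cdiff_minus; [apply cdiff_id|apply cdiff_const].
- apply cdiff_minus; [apply cdiff_const|].
  apply cdiff_mult; [apply cdiff_const|apply cdiff_id].
Qed.

Lemma mobius_self (a : C) : mobius a a = 0%C.
Proof. unfold mobius, Cdiv; replace (a - a)%C with (RtoC 0) by ring; apply Cmult_0_l. Qed.

Lemma mobius_0 (a : C) : mobius a 0%C = (- a)%C.
Proof.
unfold mobius; replace (1 - Cconj a * 0)%C with (RtoC 1) by ring; field.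
Qed.

Lemma Cconj_opp (a : C) : Cconj (- a) = (- Cconj a)%C.
Proof. apply injective_projections; simpl; ring. Qed.

Lemma mobius_opp_K (a z : C) : Cmod a < 1 -> Cmod z <= 1 -> mobius (- a) (mobius a z) = z.
Proof.
intros Ha Hz; pose proof (mobius_den a z Ha Hz) as D.
pose proof (mobius_den a a Ha (Rlt_le _ _ Ha)) as Da.
unfold mobius; rewrite Cconj_opp; field.
split; [exact D|intros E; apply Da; rewrite <- E; ring].
Qed.

(* Divide K by the Blaschke factor of the disk of radius rho, which is unimodular on |t| = rho,
   and let rho tend to 1. *)
Lemma schwarz_center (K : C -> C) (e : C) (M : R) :
  0 < Cmod e < 1 ->
  (forall t, Cmod t < 1 -> cdiff K t) -> (forall t, Cmod t < 1 -> Cmod (K t) <= M) ->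
  K e = 0%C -> Cmod (K 0%C) <= M * Cmod e.
Proof.
intros He HK HM Ke.
assert (He0 : e <> 0%C) by (apply Cmod_gt_0; lra).
assert (B : forall rho, Cmod e < rho < 1 -> Cmod (K 0%C) * rho <= M * Cmod e).
{ intros rho Hr.
  assert (Hr0 : RtoC rho <> 0%C) by (apply RtoC_neq_0; lra).
  (* Dividing by t - e leaves [K] over the Blaschke factor rho (t - e) / (rho^2 - conj(e) t). *)
  destruct (removable_quotient (fun t => K t * ((rho * rho - Cconj e * t) / rho))%C e rho) as (k & E & Hc & Hd).
  - intros t Ht; apply cdiff_mult; [apply HK; lra|].
    apply cdiff_div; [|apply cdiff_const|exact Hr0].
    apply cdiff_minus; [apply cdiff_const|].
    apply cdiff_mult; [apply cdiff_const|apply cdiff_id].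
  - lra.
  - rewrite Ke; ring.
  - pose proof (Cmod_0_center k e rho M ltac:(lra) Hc Hd) as B.
    rewrite E in B by (intros F; apply He0; symmetry; exact F).
    assert (Hme : (0 - e)%C <> 0%C) by (intros F; apply He0; replace e with (- (0 - e))%C by ring; rewrite F; ring).
    assert (Hne : (- e)%C <> 0%C) by (intros F; apply He0; replace e with (- - e)%C by ring; rewrite F; ring).
    assert (E0 : (K 0 * ((rho * rho - Cconj e * 0) / rho) / (0 - e))%C = (K 0 * rho / - e)%C)
      by (field; repeat split; assumption).
    rewrite E0, Cmod_div, Cmod_mult, Cmod_opp, Cmod_R, Rabs_pos_eq in B by (try assumption; lra).
    enough (L : Cmod (K 0%C) * rho / Cmod e <= M).
    { apply (Rmult_le_compat_r (Cmod e)) in L; [|lra].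
      replace (Cmod (K 0%C) * rho / Cmod e * Cmod e) with (Cmod (K 0%C) * rho) in L by (field; lra); exact L. }
    apply B; intros t Ht.
    assert (Nt : t <> e) by (intros ->; lra).
    assert (Nt' : (t - e)%C <> 0%C) by (intros F; apply Nt; replace t with (t - e + e)%C by ring; rewrite F; ring).
    rewrite E by exact Nt.
    rewrite Cmod_div, Cmod_mult, Cmod_div, Cmod_R, Rabs_pos_eq by (auto; lra).
    assert (Em : Cmod (rho * rho - Cconj e * t) = rho * Cmod (t - e)).
    { apply (pow_eq_inv_R 2) || apply Rsqr_inj; try apply Cmod_ge_0; [apply Rmult_le_pos; [lra|apply Cmod_ge_0]|].
      assert (Q2 : rho ^ 2 = Re t ^ 2 + Im t ^ 2) by (rewrite <- Cmod2_alt, Ht; reflexivity).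
      rewrite !Rsqr_pow2, Rpow_mult_distr, !Cmod2_alt.
      destruct e as [e1 e2], t as [t1 t2]; simpl in *.
      (* The two squared moduli differ by (rho^2 - |t|^2)(rho^2 - |e|^2), which is 0 on the
         circle. *)
      assert (Q3 : (rho ^ 2 - (t1 ^ 2 + t2 ^ 2)) * (rho ^ 2 - (e1 ^ 2 + e2 ^ 2)) = 0) by (simpl; rewrite Q2; ring).
      apply Rminus_diag_uniq; eapply eq_trans; [|exact Q3]; ring. }
    rewrite Em.
    assert (P : 0 < Cmod (t - e)) by (apply Cmod_gt_0; exact Nt').
    replace (Cmod (K t) * (rho * Cmod (t - e) / rho) / Cmod (t - e)) with (Cmod (K t)) by (field; lra).
    apply HM; lra. }
apply le_epsilon; intros eps Heps.
assert (M0 : 0 <= Cmod (K 0%C)) by apply Cmod_ge_0.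
(* A radius between |e| and 1, so close to 1 that |K 0| (1 - q) <= eps. *)
set (q := Rmax ((1 + Cmod e) / 2) (1 - eps / (Cmod (K 0%C) + 1))).
assert (Hd : 0 < eps / (Cmod (K 0%C) + 1)) by (apply Rdiv_lt_0_compat; lra).
assert (Hq : Cmod e < q < 1).
{ split; [eapply Rlt_le_trans; [|apply Rmax_l]; lra|apply Rmax_lub_lt; lra]. }
assert (Hq2 : 1 - q <= eps / (Cmod (K 0%C) + 1)) by (pose proof (Rmax_r ((1 + Cmod e) / 2) (1 - eps / (Cmod (K 0%C) + 1))); unfold q; lra).
apply (Rmult_le_compat_r (Cmod (K 0%C) + 1)) in Hq2; [|lra].
replace (eps / (Cmod (K 0%C) + 1) * (Cmod (K 0%C) + 1)) with eps in Hq2 by (field; lra).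
specialize (B q Hq); nra.
Qed.

Lemma Cmod_opp_lt (t : C) (r : R) : Cmod t < r -> Cmod (- t) < r.
Proof. rewrite Cmod_opp; auto. Qed.

Lemma mobius_opp_0 (t : C) : mobius (- t) 0%C = t.
Proof. rewrite mobius_0; ring. Qed.

(** [mobius (- t)] sends 0 to [t] and -t to 0, so the bound at [t] becomes a bound at the centre for
    a function vanishing at -t. *)
Lemma schwarz (K : C -> C) (M : R) (t : C) :
  (forall t, Cmod t < 1 -> cdiff K t) -> (forall t, Cmod t < 1 -> Cmod (K t) <= M) ->
  K 0%C = 0%C -> Cmod t < 1 -> Cmod (K t) <= M * Cmod t.
Proof.
intros HK HM K0 Ht.
destruct (Ceq_dec t 0%C) as [->|N]; [rewrite K0, Cmod_0; lra|].
assert (P : 0 < Cmod t) by (apply Cmod_gt_0; exact N).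
assert (Ht' := Cmod_opp_lt t 1 Ht).
pose proof (schwarz_center (fun s => K (mobius (- t) s)) (- t)%C M) as S.
cbv beta in S; rewrite mobius_opp_0, Cmod_opp, mobius_self in S; apply S; auto.
- intros s Hs; apply (cdiff_comp K); [apply HK, mobius_lt_1; auto|apply cdiff_mobius; auto; lra].
- intros s Hs; apply HM, mobius_lt_1; auto.
Qed.

Lemma max_principle (K : C -> C) (M : R) (t : C) :
  (forall t, Cmod t <= 1 -> cdiff K t) -> (forall t, Cmod t = 1 -> Cmod (K t) <= M) ->
  Cmod t < 1 -> Cmod (K t) <= M.
Proof.
intros HK HM Ht; assert (Ht' := Cmod_opp_lt t 1 Ht).
rewrite <- (mobius_opp_0 t) at 1.
assert (D : forall s, Cmod s <= 1 -> cdiff (fun s => K (mobius (- t) s)) s).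
{ intros s Hs; apply (cdiff_comp K); [apply HK, mobius_le_1|apply cdiff_mobius]; auto. }
(* The function is differentiable on the whole closed disk, so any nonzero interior point, here 1/2,
   can play the exceptional point. *)
apply (Cmod_0_center (fun s => K (mobius (- t) s)) (RtoC (1 / 2)) 1); auto.
- rewrite Cmod_R, Rabs_pos_eq; lra.
- intros s Hs; apply cdiff_ccont, D; exact Hs.
- intros s Hs; apply HM, mobius_eq_1; auto.
Qed.

(* Recentred at c, the quotient K(t)/t attains its maximum modulus 1 at the centre, hence equals 1
   on every circle. *)
Lemma schwarz_eq (K : C -> C) (c : C) :
  (forall t, Cmod t < 1 -> cdiff K t) -> (forall t, Cmod t < 1 -> Cmod (K t) <= 1) ->
  K 0%C = 0%C -> K c = c -> 0 < Cmod c < 1 ->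
  forall t, Cmod t < 1 -> K t = t.
Proof.
intros HK HM K0 Kc Hc.
assert (Hc' : Cmod (- c) < 1) by (rewrite Cmod_opp; lra).
assert (c0 : c <> 0%C) by (apply Cmod_gt_0; lra).
(* After recentring, the zero sits at -c; only circles of radius larger than |c| enclose it. *)
assert (far : forall s, Cmod c < Cmod s < 1 -> K (mobius (- c) s) = mobius (- c) s).
{ intros s0 Hs0; set (rho := Cmod s0) in *.
  (* With this numerator, division by s + c gives K(m(s)) / m(s), where m = [mobius (- c)]. *)
  assert (DQ : forall t, Cmod t <= rho -> cdiff (fun s => K (mobius (- c) s) * (1 - Cconj (- c) * s))%C t).
  { intros t Ht; apply cdiff_mult.
    - apply (cdiff_comp K); [apply HK, mobius_lt_1; auto; lra|apply cdiff_mobius; auto; lra].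
    - apply cdiff_minus; [apply cdiff_const|apply cdiff_mult; [apply cdiff_const|apply cdiff_id]]. }
  destruct (removable_quotient _ (- c)%C rho DQ) as (k & E & Hcont & Hd).
  - rewrite Cmod_opp; lra.
  - rewrite mobius_self, K0; ring.
  - assert (Esub : forall s, (s - - c)%C = (s + c)%C) by (intros; ring).
    assert (Nz : forall s, s <> (- c)%C -> (s - - c)%C <> 0%C).
    { intros s Hs F; apply Hs; replace s with ((s - - c) + - c)%C by ring; rewrite F; ring. }
    assert (Ek : forall s, Cmod s < 1 -> s <> (- c)%C -> (k s * mobius (- c) s)%C = K (mobius (- c) s)).
    { intros s Hs Hsc; rewrite E by exact Hsc; unfold mobius at 2.
      pose proof (mobius_den (- c) s Hc' (Rlt_le _ _ Hs)); field; split; auto. }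
    assert (N0 : forall s, s <> (- c)%C -> Cmod s < 1 -> mobius (- c) s <> 0%C).
    { intros s Hsc Hs F; apply (Nz s Hsc); apply Cmod_eq_0.
      rewrite <- (Cmod_mobius (- c) s), F, Cmod_0 by (auto; lra); ring. }
    assert (Hk : forall s, Cmod s = rho -> k s = 1%C).
    { apply (extremal_on_circle k (- c)%C rho); auto.
      - rewrite Cmod_opp; lra.
      - intros s Hs.
        assert (Hsc : s <> (- c)%C) by (intros ->; rewrite Cmod_opp in Hs; lra).
        assert (P : 0 < Cmod (mobius (- c) s)) by (apply Cmod_gt_0, N0; auto; lra).
        apply (Rmult_le_reg_r (Cmod (mobius (- c) s))); [exact P|].
        rewrite <- Cmod_mult, Ek by (auto; lra).
        apply schwarz; auto; apply mobius_lt_1; auto; lra.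
      - assert (Hsc : RtoC 0 <> (- c)%C) by (intros F; apply c0; replace c with (- - c)%C by ring; rewrite <- F; ring).
        assert (E0 := Ek 0%C ltac:(rewrite Cmod_0; lra) Hsc).
        rewrite mobius_opp_0, Kc in E0.
        replace (k 0%C) with (k 0%C * c / c)%C by (field; exact c0); rewrite E0; field; exact c0. }
    assert (Hsc : s0 <> (- c)%C) by (intros F; unfold rho in Hs0; rewrite F, Cmod_opp in Hs0; lra).
    rewrite <- (Ek s0), Hk by (auto; unfold rho in *; lra); ring. }
intros t Ht.
set (s := mobius c t).
assert (Hs : Cmod s < 1) by (apply mobius_lt_1; lra).
set (rho := (1 + Rmax (Cmod c) (Cmod s)) / 2).
assert (Hr : Cmod c < rho < 1 /\ Cmod s < rho).
{ pose proof (Rmax_l (Cmod c) (Cmod s)); pose proof (Rmax_r (Cmod c) (Cmod s)).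
  assert (Rmax (Cmod c) (Cmod s) < 1) by (apply Rmax_lub_lt; lra). unfold rho; lra. }
assert (Hr0 : RtoC rho <> 0%C) by (apply RtoC_neq_0; pose proof (Cmod_ge_0 c); lra).
assert (Cr : Cmod rho = rho) by (rewrite Cmod_R, Rabs_pos_eq; pose proof (Cmod_ge_0 c); lra).
(* By [far] the difference vanishes on the circle of radius rho, so the maximum principle with bound
   0, rescaled to the unit disk, kills it inside. *)
assert (Z : Cmod (K (mobius (- c) (rho * (s / rho))) - mobius (- c) (rho * (s / rho))) <= 0).
{ apply (max_principle (fun w => K (mobius (- c) (rho * w)) - mobius (- c) (rho * w))%C).
  - intros w Hw.
    assert (Hw' : Cmod (rho * w) < 1) by (rewrite Cmod_mult, Cr; pose proof (Cmod_ge_0 c); pose proof (Cmod_ge_0 w); nra).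
    assert (D : cdiff (fun w => mobius (- c) (rho * w))%C w).
    { apply (cdiff_comp (mobius (- c)) (fun w => rho * w)%C); [apply cdiff_mobius; auto; lra|].
      apply cdiff_mult; [apply cdiff_const|apply cdiff_id]. }
    apply cdiff_minus; [|exact D].
    apply (cdiff_comp K (fun w => mobius (- c) (rho * w))%C); [apply HK, mobius_lt_1; auto|exact D].
  - intros w Hw; rewrite far by (rewrite Cmod_mult, Cr, Hw; lra).
    unfold Cminus; rewrite Cplus_opp_r, Cmod_0; lra.
  - rewrite Cmod_div, Cr by exact Hr0.
    pose proof (Cmod_ge_0 c).
    apply (Rmult_lt_reg_r rho); [lra|]; unfold Rdiv; rewrite Rmult_assoc, Rinv_l; lra. }
replace (rho * (s / rho))%C with s in Z by (field; exact Hr0).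
unfold s in Z; rewrite mobius_opp_K in Z by lra.
assert (Z0 : (K t - t)%C = 0%C) by (apply Cmod_eq_0; pose proof (Cmod_ge_0 (K t - t)); lra).
replace (K t) with ((K t - t) + t)%C by ring; rewrite Z0; ring.
Qed.

(** * Polynomials in two variables and their uniform limits *)


Lemma sum_n_truncate (f : nat -> C) (N k : nat) :
  sum_n (fun i => if (i <=? N)%nat then f i else RtoC 0) (N + k) = sum_n f N.
Proof.
induction k as [|k IH].
- rewrite Nat.add_0_r; apply sum_n_ext_loc; intros i Hi.
  apply Nat.leb_le in Hi; rewrite Hi; reflexivity.
- rewrite Nat.add_succ_r, sum_Sn, IH.
  replace (S (N + k) <=? N)%nat with false by (symmetry; apply Nat.leb_gt; lia).
  exact (plus_zero_r (G := C_AbelianMonoid) _).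
Qed.

Lemma sum_n_delta (x : C) (m N : nat) : (m <= N)%nat ->
  sum_n (fun i => if (i =? m)%nat then x else RtoC 0) N = x.
Proof.
assert (Z : forall M, (M < m)%nat -> sum_n (fun i => if (i =? m)%nat then x else RtoC 0) M = RtoC 0).
{ intros M HM; rewrite (sum_n_ext_loc _ (fun _ => zero)).
  - induction M as [|M IH]; [apply sum_O|rewrite sum_Sn, IH by lia; exact (plus_zero_r (G := C_AbelianMonoid) _)].
  - intros i Hi; replace (i =? m)%nat with false by (symmetry; apply Nat.eqb_neq; lia); reflexivity. }
intros H; induction N as [|N IH].
- rewrite sum_O; replace m with O by lia; reflexivity.
- rewrite sum_Sn; destruct (Nat.eq_dec m (S N)) as [E|E].
  + rewrite Z by lia; rewrite E, Nat.eqb_refl; exact (plus_zero_l (G := C_AbelianMonoid) _).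
  + rewrite IH by lia; replace (S N =? m)%nat with false by (symmetry; apply Nat.eqb_neq; lia).
    exact (plus_zero_r (G := C_AbelianMonoid) _).
Qed.

Lemma polynomial2_ext (p q : C * C -> C) :
  (forall z, p z = q z) -> polynomial2 p -> polynomial2 q.
Proof. intros H (N & a & E); exists N, a; intros z; rewrite <- H; apply E. Qed.

Lemma polynomial2_monomial (c : C) (m n : nat) :
  polynomial2 (fun z => (c * fst z ^ m * snd z ^ n)%C).
Proof.
exists (m + n)%nat, (fun i j => if (i =? m)%nat then (if (j =? n)%nat then c else RtoC 0) else RtoC 0).
intros z; rewrite <- (sum_n_delta (c * fst z ^ m * snd z ^ n) m (m + n)) by lia.
apply sum_n_ext; intros i; destruct (Nat.eqb_spec i m) as [->|_].
- rewrite <- (sum_n_delta (c * fst z ^ m * snd z ^ n) n (m + n)) by lia.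
  apply sum_n_ext; intros j; destruct (Nat.eqb_spec j n) as [->|_]; [reflexivity|rewrite !Cmult_0_l; reflexivity].
- symmetry; rewrite (sum_n_ext _ (fun _ => zero)) by (intros j; rewrite !Cmult_0_l; reflexivity).
  induction (m + n)%nat as [|M IH]; [apply sum_O|rewrite sum_Sn, IH; exact (plus_zero_r (G := C_AbelianMonoid) _)].
Qed.

(** [polynomial2] has one bound for both indices; zero padding brings two polynomials to a common
    bound so that coefficients can be added. *)
Lemma polynomial2_pad (N M : nat) (a : nat -> nat -> C) (z : C * C) : (N <= M)%nat ->
  sum_n (fun i => sum_n (fun j => a i j * fst z ^ i * snd z ^ j)%C N) N =
  sum_n (fun i => sum_n (fun j => (if (i <=? N)%nat then if (j <=? N)%nat then a i j else RtoC 0 else RtoC 0)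
    * fst z ^ i * snd z ^ j)%C M) M.
Proof.
intros H; replace M with (N + (M - N))%nat by lia; set (k := (M - N)%nat).
rewrite <- (sum_n_truncate _ N k); apply sum_n_ext; intros i; destruct (i <=? N)%nat.
- rewrite <- (sum_n_truncate _ N k); apply sum_n_ext; intros j.
  destruct (j <=? N)%nat; [reflexivity|rewrite !Cmult_0_l; reflexivity].
- symmetry; rewrite (sum_n_ext _ (fun _ => zero)) by (intros j; rewrite !Cmult_0_l; reflexivity).
  induction (N + k)%nat as [|L IH]; [apply sum_O|rewrite sum_Sn, IH; exact (plus_zero_r (G := C_AbelianMonoid) _)].
Qed.

Lemma polynomial2_plus (p q : C * C -> C) :
  polynomial2 p -> polynomial2 q -> polynomial2 (fun z => (p z + q z)%C).
Proof.
intros (N & a & Ea) (M & b & Eb); set (L := Nat.max N M).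
set (pad := fun (K : nat) (c : nat -> nat -> C) i j =>
  if (i <=? K)%nat then if (j <=? K)%nat then c i j else RtoC 0 else RtoC 0).
exists L, (fun i j => (pad N a i j + pad M b i j)%C); intros z; rewrite Ea, Eb.
rewrite (polynomial2_pad N L a z), (polynomial2_pad M L b z) by (unfold L; lia).
symmetry; etransitivity; [|apply (sum_n_plus (G := C_AbelianMonoid))].
apply sum_n_ext; intros i.
etransitivity; [|apply (sum_n_plus (G := C_AbelianMonoid))].
apply sum_n_ext; intros j.
rewrite !Cmult_plus_distr_r; reflexivity.
Qed.

Lemma polynomial2_sum (f : nat -> C * C -> C) (N : nat) :
  (forall i, polynomial2 (f i)) -> polynomial2 (fun z => sum_n (fun i => f i z) N).
Proof.
intros H; induction N as [|N IH].
- apply polynomial2_ext with (2 := H O); intros z; symmetry; apply sum_O.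
- eapply polynomial2_ext; [|apply polynomial2_plus; [exact IH|exact (H (S N))]].
  intros z; rewrite sum_Sn; reflexivity.
Qed.

Lemma polynomial2_sum_mult (f : nat -> C * C -> C) (g : C * C -> C) (N : nat) :
  (forall i, polynomial2 (fun z => f i z * g z)%C) ->
  polynomial2 (fun z => sum_n (fun i => f i z) N * g z)%C.
Proof.
intros H; apply polynomial2_ext with (2 := polynomial2_sum _ N H); intros z.
exact (sum_n_mult_r (K := C_Ring) (g z) (fun i => f i z) N).
Qed.

Lemma Cpow_add_r (x : C) (m n : nat) : (x ^ (m + n) = x ^ m * x ^ n)%C.
Proof. induction m as [|m IH]; simpl; [ring|rewrite IH; ring]. Qed.

(** Distributing one finite sum at a time reduces the product to monomials and avoids a convolution
    formula for the coefficients. *)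
Lemma polynomial2_mult (p q : C * C -> C) :
  polynomial2 p -> polynomial2 q -> polynomial2 (fun z => (p z * q z)%C).
Proof.
intros (N & a & Ea) (M & b & Eb).
apply polynomial2_ext with (fun z =>
  sum_n (fun i => sum_n (fun j => (a i j * fst z ^ i * snd z ^ j)%C) N) N * q z)%C;
  [intros z; rewrite Ea; reflexivity|].
apply (polynomial2_sum_mult (fun i z => sum_n (fun j => (a i j * fst z ^ i * snd z ^ j)%C) N)); intros i.
apply (polynomial2_sum_mult (fun j z => a i j * fst z ^ i * snd z ^ j)%C); intros j.
apply polynomial2_ext with (fun z =>
  sum_n (fun k => sum_n (fun l => (b k l * fst z ^ k * snd z ^ l)%C) M) M * (a i j * fst z ^ i * snd z ^ j))%C;
  [intros z; rewrite Eb; apply Cmult_comm|].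
apply (polynomial2_sum_mult (fun k z => sum_n (fun l => (b k l * fst z ^ k * snd z ^ l)%C) M)); intros k.
apply (polynomial2_sum_mult (fun l z => b k l * fst z ^ k * snd z ^ l)%C); intros l.
eapply polynomial2_ext; [|apply (polynomial2_monomial (a i j * b k l) (i + k) (j + l))].
intros z; cbv beta; rewrite !Cpow_add_r; ring.
Qed.

Lemma polynomial2_const (c : C) : polynomial2 (fun _ => c).
Proof. eapply polynomial2_ext; [|apply (polynomial2_monomial c 0 0)]; intros z; simpl; ring. Qed.

Lemma polynomial2_fst : polynomial2 fst.
Proof. eapply polynomial2_ext; [|apply (polynomial2_monomial 1 1 0)]; intros z; simpl; ring. Qed.

Lemma polynomial2_snd : polynomial2 snd.
Proof. eapply polynomial2_ext; [|apply (polynomial2_monomial 1 0 1)]; intros z; simpl; ring. Qed.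

(** Polynomials as the algebra generated by constants and coordinates: an analytic property then
    needs checking only on generators, sums and products. *)
Lemma polynomial2_closed_ind (P : (C * C -> C) -> Prop) :
  (forall f g, (forall z, f z = g z) -> P f -> P g) ->
  (forall c, P (fun _ => c)) -> P fst -> P snd ->
  (forall f g, P f -> P g -> P (fun z => f z + g z)%C) ->
  (forall f g, P f -> P g -> P (fun z => f z * g z)%C) ->
  forall p, polynomial2 p -> P p.
Proof.
intros Pext Pc P1 P2 Pp Pm p (N & a & E).
assert (Psum : forall (f : nat -> C * C -> C) M, (forall i, P (f i)) -> P (fun z => sum_n (fun i => f i z) M)).
{ intros f M H; induction M as [|M IH].
  - apply Pext with (2 := H O); intros z; symmetry; apply sum_O.
  - eapply Pext; [|apply Pp; [exact IH|exact (H (S M))]].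
    intros z; rewrite sum_Sn; reflexivity. }
assert (Ppow : forall (f : C * C -> C) n, P f -> P (fun z => f z ^ n)%C).
{ intros f n H; induction n as [|n IH]; [exact (Pc (RtoC 1))|exact (Pm f _ H IH)]. }
eapply Pext; [intros z; symmetry; apply E|].
apply Psum; intros i; apply Psum; intros j; auto.
Qed.

Lemma polynomial2_cdiff (p : C * C -> C) (mu nu : C -> C) (t : C) :
  polynomial2 p -> cdiff mu t -> cdiff nu t -> cdiff (fun s => p (mu s, nu s)) t.
Proof.
intros Hp Hmu Hnu; revert p Hp; refine (polynomial2_closed_ind _ _ _ _ _ _ _); auto.
- intros f g E H; apply cdiff_ext_loc with (r := 1) (3 := H); [lra|intros; apply E].
- intros c; apply cdiff_const.
- intros f g; apply cdiff_plus.
- intros f g; apply cdiff_mult.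
Qed.

Lemma polynomial2_continuous (p : C * C -> C) (z : C * C) (eps : R) :
  polynomial2 p -> 0 < eps -> exists delta, 0 < delta /\
    forall w, Cmod (fst w - fst z) < delta -> Cmod (snd w - snd z) < delta ->
      Cmod (p w - p z) < eps.
Proof.
intros Hp; revert eps; revert p Hp; refine (polynomial2_closed_ind _ _ _ _ _ _ _).
- intros f g E H eps Heps; destruct (H eps Heps) as (d & Hd & B); exists d; split; auto.
  intros w; rewrite <- !E; apply B.
- intros c eps Heps; exists 1; split; [lra|]; intros.
  unfold Cminus; rewrite Cplus_opp_r, Cmod_0; exact Heps.
- intros eps Heps; exists eps; auto.
- intros eps Heps; exists eps; auto.
- intros f g Hf Hg eps Heps.
  destruct (Hf (eps / 2) ltac:(lra)) as (d1 & Hd1 & B1).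
  destruct (Hg (eps / 2) ltac:(lra)) as (d2 & Hd2 & B2).
  exists (Rmin d1 d2); split; [apply Rmin_pos; auto|]; intros w H1 H2.
  assert (m1 := Rmin_l d1 d2); assert (m2 := Rmin_r d1 d2).
  replace (f w + g w - (f z + g z))%C with ((f w - f z) + (g w - g z))%C by ring.
  eapply Rle_lt_trans; [apply Cmod_triangle|].
  specialize (B1 w ltac:(lra) ltac:(lra)); specialize (B2 w ltac:(lra) ltac:(lra)); lra.
- intros f g Hf Hg eps Heps.
  set (M := 1 + Cmod (f z) + Cmod (g z)).
  pose proof (Cmod_ge_0 (f z)); pose proof (Cmod_ge_0 (g z)).
  assert (HM : 1 <= M) by (unfold M; lra).
  assert (He : 0 < eps / (2 * M)) by (apply Rdiv_lt_0_compat; lra).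
  destruct (Hf (eps / (2 * M)) He) as (d1 & Hd1 & B1).
  (* The cap 1 keeps |g w| <= 1 + |g z| <= M. *)
  destruct (Hg (Rmin 1 (eps / (2 * M))) ltac:(apply Rmin_pos; lra)) as (d2 & Hd2 & B2).
  exists (Rmin d1 d2); split; [apply Rmin_pos; auto|]; intros w H1 H2.
  assert (m1 := Rmin_l d1 d2); assert (m2 := Rmin_r d1 d2).
  specialize (B1 w ltac:(lra) ltac:(lra)); specialize (B2 w ltac:(lra) ltac:(lra)).
  assert (m3 := Rmin_l 1 (eps / (2 * M))); assert (m4 := Rmin_r 1 (eps / (2 * M))).
  replace (f w * g w - f z * g z)%C with ((f w - f z) * g w + f z * (g w - g z))%C by ring.
  eapply Rle_lt_trans; [apply Cmod_triangle|]; rewrite !Cmod_mult.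
  pose proof (Cmod_triangle (g w - g z) (g z)) as T.
  replace (g w - g z + g z)%C with (g w) in T by ring.
  pose proof (Cmod_ge_0 (f w - f z)); pose proof (Cmod_ge_0 (g w - g z)); pose proof (Cmod_ge_0 (g w)).
  assert (Cmod (f w - f z) * Cmod (g w) <= Cmod (f w - f z) * M) by (apply Rmult_le_compat_l; unfold M; lra).
  assert (Cmod (f z) * Cmod (g w - g z) <= M * Cmod (g w - g z)) by (apply Rmult_le_compat_r; unfold M; lra).
  assert (E : eps = eps / (2 * M) * M + M * (eps / (2 * M))) by (field; lra).
  assert (Cmod (f w - f z) * M < eps / (2 * M) * M) by (apply Rmult_lt_compat_r; lra).
  assert (M * Cmod (g w - g z) <= M * (eps / (2 * M))) by (apply Rmult_le_compat_l; lra).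
  lra.
Qed.

Lemma polynomial2_bounded (p : C * C -> C) : polynomial2 p ->
  exists M, 0 < M /\ forall z, bidisk z -> Cmod (p z) <= M.
Proof.
revert p; refine (polynomial2_closed_ind _ _ _ _ _ _ _).
- intros f g E (M & HM & B); exists M; split; auto; intros z Hz; rewrite <- E; auto.
- intros c; exists (Cmod c + 1); split; [pose proof (Cmod_ge_0 c); lra|intros; lra].
- exists 1; split; [lra|]; intros z [H _]; apply Rlt_le, H.
- exists 1; split; [lra|]; intros z [_ H]; apply Rlt_le, H.
- intros f g (M1 & H1 & B1) (M2 & H2 & B2); exists (M1 + M2); split; [lra|]; intros z Hz.
  eapply Rle_trans; [apply Cmod_triangle|]; specialize (B1 z Hz); specialize (B2 z Hz); lra.
- intros f g (M1 & H1 & B1) (M2 & H2 & B2); exists (M1 * M2); split; [apply Rmult_lt_0_compat; auto|].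
  intros z Hz; rewrite Cmod_mult; apply Rmult_le_compat; auto using Cmod_ge_0.
Qed.

(** The extension property speaks of polynomials only; rational peak functions reach it through this
    uniform closure. *)
Definition poly_approx (F : C * C -> C) : Prop :=
  forall eps : R, 0 < eps -> exists p, polynomial2 p /\
    forall z, bidisk z -> Cmod (F z - p z) <= eps.

Lemma poly_approx_poly (p : C * C -> C) : polynomial2 p -> poly_approx p.
Proof.
intros Hp eps Heps; exists p; split; auto; intros z _.
unfold Cminus; rewrite Cplus_opp_r, Cmod_0; lra.
Qed.

Lemma poly_approx_plus (F G : C * C -> C) :
  poly_approx F -> poly_approx G -> poly_approx (fun z => F z + G z)%C.
Proof.
intros HF HG eps Heps.
destruct (HF (eps / 2) ltac:(lra)) as (p & Hp & Bp).
destruct (HG (eps / 2) ltac:(lra)) as (q & Hq & Bq).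
exists (fun z => p z + q z)%C; split; [apply polynomial2_plus; auto|]; intros z Hz.
replace (F z + G z - (p z + q z))%C with ((F z - p z) + (G z - q z))%C by ring.
eapply Rle_trans; [apply Cmod_triangle|]; specialize (Bp z Hz); specialize (Bq z Hz); lra.
Qed.

Lemma poly_approx_bounded (F : C * C -> C) : poly_approx F ->
  exists M, 0 < M /\ forall z, bidisk z -> Cmod (F z) <= M.
Proof.
intros HF; destruct (HF 1 Rlt_0_1) as (p & Hp & Bp).
destruct (polynomial2_bounded p Hp) as (M & HM & B).
exists (1 + M); split; [lra|]; intros z Hz.
pose proof (Cmod_triangle (F z - p z) (p z)) as T.
replace (F z - p z + p z)%C with (F z) in T by ring.
specialize (Bp z Hz); specialize (B z Hz); lra.
Qed.

Lemma poly_approx_mult (F G : C * C -> C) :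
  poly_approx F -> poly_approx G -> poly_approx (fun z => F z * G z)%C.
Proof.
intros HF HG eps Heps.
destruct (poly_approx_bounded F HF) as (M & HM & BF).
(* The order matters: the accuracy asked of [p] depends on the bound for [q]. *)
destruct (HG (eps / (2 * M)) ltac:(apply Rdiv_lt_0_compat; lra)) as (q & Hq & Bq).
destruct (polynomial2_bounded q Hq) as (N & HN & BN).
destruct (HF (eps / (2 * N)) ltac:(apply Rdiv_lt_0_compat; lra)) as (p & Hp & Bp).
exists (fun z => p z * q z)%C; split; [apply polynomial2_mult; auto|]; intros z Hz.
replace (F z * G z - p z * q z)%C with (F z * (G z - q z) + (F z - p z) * q z)%C by ring.
eapply Rle_trans; [apply Cmod_triangle|]; rewrite !Cmod_mult.
assert (E : eps = M * (eps / (2 * M)) + eps / (2 * N) * N) by (field; lra).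
rewrite E; apply Rplus_le_compat; apply Rmult_le_compat; auto using Cmod_ge_0.
Qed.

Lemma poly_approx_limit (F : C * C -> C) :
  (forall eps, 0 < eps -> exists G, poly_approx G /\ forall z, bidisk z -> Cmod (F z - G z) <= eps) ->
  poly_approx F.
Proof.
intros H eps Heps.
destruct (H (eps / 2) ltac:(lra)) as (G & HG & BG).
destruct (HG (eps / 2) ltac:(lra)) as (p & Hp & Bp).
exists p; split; auto; intros z Hz.
replace (F z - p z)%C with ((F z - G z) + (G z - p z))%C by ring.
eapply Rle_trans; [apply Cmod_triangle|]; specialize (BG z Hz); specialize (Bp z Hz); lra.
Qed.

Fixpoint geometric_sum (u : C * C -> C) (n : nat) (z : C * C) : C :=
  match n with O => RtoC 0 | S n => (1 + u z * geometric_sum u n z)%C end.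

(** [geometric_sum] is the partial sum in Horner form, and its remainder u^n / (1 - u) is at most
    q^n / (1 - q) uniformly. Both the Moebius maps and the peak factor have denominators 1 - u of
    this kind. *)
Lemma poly_approx_geometric (u : C * C -> C) (q : R) :
  poly_approx u -> q < 1 -> (forall z, bidisk z -> Cmod (u z) <= q) ->
  poly_approx (fun z => / (1 - u z))%C.
Proof.
intros Hu Hq B; apply poly_approx_limit; intros eps Heps.
assert (Q0 : 0 <= q).
{ eapply Rle_trans; [apply Cmod_ge_0|apply (B (RtoC 0, RtoC 0))].
  split; unfold disk; simpl; rewrite Cmod_0; lra. }
destruct (pow_lt_1_zero q ltac:(rewrite Rabs_pos_eq; lra) (eps * (1 - q)) ltac:(apply Rmult_lt_0_compat; lra)) as [n Hn].
specialize (Hn n (Nat.le_refl n)); rewrite Rabs_pos_eq in Hn by (apply pow_le; lra).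
exists (geometric_sum u n); split.
- clear Hn; induction n as [|n IH]; simpl.
  + apply poly_approx_poly, polynomial2_const.
  + apply poly_approx_plus; [apply poly_approx_poly, polynomial2_const|].
    apply poly_approx_mult; auto.
- intros z Hz; specialize (B z Hz).
  assert (D : 1 - q <= Cmod (1 - u z)).
  { pose proof (Cmod_triangle_rev 1 (1 - u z)) as T.
    replace (1 - u z - 1)%C with (- u z)%C in T by ring; rewrite Cmod_1, Cmod_opp in T; lra. }
  assert (D0 : (1 - u z)%C <> 0%C) by (apply Cmod_gt_0; lra).
  assert (E : forall m, Cmod (/ (1 - u z) - geometric_sum u m z) <= q ^ m / (1 - q)).
  { induction m as [|m IH]; simpl.
    - unfold Cminus at 1; rewrite Copp_0, Cplus_0_r, Cmod_inv by exact D0.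
      unfold Rdiv; rewrite Rmult_1_l; apply Rinv_le_contravar; lra.
    - replace (/ (1 - u z) - (1 + u z * geometric_sum u m z))%C
        with (u z * (/ (1 - u z) - geometric_sum u m z))%C by (field; exact D0).
      rewrite Cmod_mult; unfold Rdiv; rewrite Rmult_assoc.
      apply Rmult_le_compat; auto using Cmod_ge_0. }
  eapply Rle_trans; [apply E|].
  apply (Rmult_le_reg_r (1 - q)); [lra|].
  unfold Rdiv; rewrite Rmult_assoc, Rinv_l; lra.
Qed.

(** * Peak functions *)


(** Chain rule, which brings the extension back to one variable. It is done with explicit epsilons
    because the differential of [g] lives on the product module while [cdiff] uses [Cmod] balls. *)
Lemma holomorphic_bidisk_curve (g : C * C -> C) (mu nu : C -> C) (t : C) :
  holomorphic_bidisk g -> bidisk (mu t, nu t) -> cdiff mu t -> cdiff nu t ->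
  cdiff (fun s => g (mu s, nu s)) t.
Proof.
intros Hg Hb Hmu Hnu.
destruct (Hg _ Hb) as [l [Hl Hd]].
pose proof (cdiff_ccont _ _ Hmu) as Cmu; pose proof (cdiff_ccont _ _ Hnu) as Cnu.
apply cdiffP in Hmu; destruct Hmu as [m' Hmu].
apply cdiffP in Hnu; destruct Hnu as [n' Hnu].
set (l1 := l (RtoC 1, RtoC 0) : C); set (l2 := l (RtoC 0, RtoC 1) : C).
assert (El : forall x y : C, l (x, y) = (x * l1 + y * l2)%C).
{ intros x y.
  pose proof (linear_scal _ Hl x (RtoC 1, RtoC 0)) as A1.
  pose proof (linear_scal _ Hl y (RtoC 0, RtoC 1)) as A2.
  pose proof (linear_plus _ Hl (scal x (RtoC 1, RtoC 0)) (scal y (RtoC 0, RtoC 1))) as A.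
  etransitivity; [|etransitivity; [exact A|exact (f_equal2 Cplus A1 A2)]]; f_equal.
  apply injective_projections;
    [change (x = (x * 1 + y * 0)%C)|change (y = (x * 0 + y * 1)%C)]; ring. }
apply cdiffP; exists (m' * l1 + n' * l2)%C; intros eps Heps.
(* M is the sum of Lipschitz bounds 1 + |m'| and 1 + |n'| for the two coordinates; [e1] controls the
   remainder of [g] and [e2] those of [mu] and [nu], each for eps / 2. *)
set (M := 2 + Cmod m' + Cmod n'); set (N := 1 + Cmod l1 + Cmod l2).
pose proof (Cmod_ge_0 m'); pose proof (Cmod_ge_0 n'); pose proof (Cmod_ge_0 l1); pose proof (Cmod_ge_0 l2).
assert (HM : 2 <= M) by (unfold M; lra). assert (HN : 1 <= N) by (unfold N; lra).
set (e1 := eps / (2 * M)); assert (He1 : 0 < e1) by (apply Rdiv_lt_0_compat; lra).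
set (e2 := Rmin 1 (eps / (2 * N))).
assert (He2 : 0 < e2) by (apply Rmin_pos; [lra|apply Rdiv_lt_0_compat; lra]).
destruct (Hd (mu t, nu t) (fun P HP => HP) (mkposreal e1 He1)) as [d0 B0].
destruct (Cmu d0 (cond_pos d0)) as (d1 & Hd1 & B1).
destruct (Cnu d0 (cond_pos d0)) as (d2 & Hd2 & B2).
destruct (Hmu e2 He2) as (d3 & Hd3 & B3).
destruct (Hnu e2 He2) as (d4 & Hd4 & B4).
exists (Rmin (Rmin d1 d2) (Rmin d3 d4)); split; [repeat apply Rmin_pos; assumption|].
intros s Hs.
pose proof (Rmin_l (Rmin d1 d2) (Rmin d3 d4)); pose proof (Rmin_r (Rmin d1 d2) (Rmin d3 d4)).
pose proof (Rmin_l d1 d2); pose proof (Rmin_r d1 d2); pose proof (Rmin_l d3 d4); pose proof (Rmin_r d3 d4).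
specialize (B1 s ltac:(lra)); specialize (B2 s ltac:(lra));
specialize (B3 s ltac:(lra)); specialize (B4 s ltac:(lra)).
assert (B : Cmod (g (mu s, nu s) - g (mu t, nu t) - l (mu s - mu t, nu s - nu t)%C)
  <= e1 * (Cmod (mu s - mu t) + Cmod (nu s - nu t))).
{ eapply Rle_trans; [apply (B0 (mu s, nu s)); split; apply C_NormedModule_mixin_compat1; assumption|].
  apply Rmult_le_compat_l; [simpl; lra|].
  change (sqrt (Cmod (mu s - mu t) ^ 2 + Cmod (nu s - nu t) ^ 2) <= Cmod (mu s - mu t) + Cmod (nu s - nu t)).
  pose proof (Cmod_ge_0 (mu s - mu t)); pose proof (Cmod_ge_0 (nu s - nu t)).
  rewrite <- (sqrt_pow2 (Cmod (mu s - mu t) + Cmod (nu s - nu t))) by lra.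
  apply sqrt_le_1_alt; nra. }
rewrite El in B.
set (h := Cmod (s - t)) in *.
assert (h0 : 0 <= h) by apply Cmod_ge_0.
assert (m1 : e2 <= 1) by apply Rmin_l. assert (m2 : e2 <= eps / (2 * N)) by apply Rmin_r.
assert (D1 : Cmod (mu s - mu t) <= (1 + Cmod m') * h).
{ pose proof (Cmod_triangle (mu s - mu t - (s - t) * m') ((s - t) * m')) as T.
  replace (mu s - mu t - (s - t) * m' + (s - t) * m')%C with (mu s - mu t)%C in T by ring.
  rewrite Cmod_mult in T; fold h in T; nra. }
assert (D2 : Cmod (nu s - nu t) <= (1 + Cmod n') * h).
{ pose proof (Cmod_triangle (nu s - nu t - (s - t) * n') ((s - t) * n')) as T.
  replace (nu s - nu t - (s - t) * n' + (s - t) * n')%C with (nu s - nu t)%C in T by ring.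
  rewrite Cmod_mult in T; fold h in T; nra. }
set (X := (g (mu s, nu s) - g (mu t, nu t) - ((mu s - mu t) * l1 + (nu s - nu t) * l2))%C) in *.
replace (g (mu s, nu s) - g (mu t, nu t) - (s - t) * (m' * l1 + n' * l2))%C
  with (X + ((mu s - mu t - (s - t) * m') * l1 + (nu s - nu t - (s - t) * n') * l2))%C by (unfold X; ring).
eapply Rle_trans; [apply Cmod_triangle|].
eapply Rle_trans; [apply Rplus_le_compat_l, Cmod_triangle|]; rewrite !Cmod_mult.
assert (E1 : e1 * (Cmod (mu s - mu t) + Cmod (nu s - nu t)) <= eps / 2 * h).
{ apply Rle_trans with (e1 * (M * h)); [apply Rmult_le_compat_l; unfold M; lra|].
  right; unfold e1; field; lra. }
assert (E2 : Cmod (mu s - mu t - (s - t) * m') * Cmod l1 + Cmod (nu s - nu t - (s - t) * n') * Cmod l2 <= eps / 2 * h).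
{ apply Rle_trans with (e2 * h * N).
  - unfold N.
    assert (Cmod (mu s - mu t - (s - t) * m') * Cmod l1 <= e2 * h * Cmod l1) by (apply Rmult_le_compat_r; auto).
    assert (Cmod (nu s - nu t - (s - t) * n') * Cmod l2 <= e2 * h * Cmod l2) by (apply Rmult_le_compat_r; auto).
    assert (0 <= e2 * h) by (apply Rmult_le_pos; lra). lra.
  - apply Rle_trans with (eps / (2 * N) * h * N); [|right; field; lra].
    apply Rmult_le_compat_r; [lra|]; apply Rmult_le_compat_r; lra. }
lra.
Qed.

(** 2 / (1 - qs) - 1 is the Herglotz kernel (1 + qs) / (1 - qs), and its real part is the Poisson
    kernel; the denominator is cleared. *)
Lemma Re_herglotz (q : R) (s : C) : (1 - q * s)%C <> 0%C ->
  Re (2 / (1 - q * s) - 1)%C * Cmod (1 - q * s) ^ 2 = 1 - q ^ 2 * Cmod s ^ 2.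
Proof.
intros H.
assert (P : 0 < Cmod (1 - q * s)) by (apply Cmod_gt_0; exact H).
assert (P2 : 0 < Cmod (1 - q * s) ^ 2) by (apply pow_lt; exact P).
rewrite Cmod2_alt in *; rewrite (Cmod2_alt s).
destruct s as [x y]; simpl in *; field.
intros E; lra.
Qed.

(* With q close to 1, the function (1+qs)/(1-qs) has positive real part on the disk, bounded below
   at c but small near the circle away from s = 1. *)
Lemma peak_multiplier (c : C) (b h : R) :
  Cmod c < 1 -> 0 < b -> 0 < h ->
  exists A B q : R, 0 < q < 1 /\ 1 < Cmod (A + B * / (1 - q * c)) /\
    forall s : C, Cmod s <= 1 -> Cmod s <= 1 - b \/ h <= Cmod (s - 1) ->
      Cmod (s * (A + B * / (1 - q * s))) <= 1.
Proof.
intros Hc Hb Hh.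
pose proof (Cmod_ge_0 c) as c0.
(* At [c] the Poisson kernel has numerator at least 8 * C0 and denominator at most 4, hence is at
   least 2 * C0; subtracting C0 in [H] leaves a gain of C0. *)
set (C0 := (1 - Cmod c ^ 2) / 8).
assert (HC0 : 0 < C0 <= 1 / 8) by (unfold C0; split; nra).
(* k <= b makes the first alternative imply |s| <= 1 - k; k <= h / 2 gives |1 - qs| >= h / 2; k <=
   h^2 C0 / 32 then bounds the kernel by 16 k / h^2 <= C0 / 2. *)
set (k := Rmin (Rmin b (h / 2)) (Rmin (h ^ 2 * C0 / 32) (1 / 2))).
assert (h2 : 0 < h ^ 2) by (apply pow_lt; exact Hh).
assert (k0 : 0 < k).
{ unfold k; repeat apply Rmin_pos; try lra; apply Rdiv_lt_0_compat; [apply Rmult_lt_0_compat; lra|lra]. }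
assert (kb : k <= b) by (eapply Rle_trans; [apply Rmin_l|apply Rmin_l]).
assert (kh : k <= h / 2) by (eapply Rle_trans; [apply Rmin_l|apply Rmin_r]).
assert (kc : k <= h ^ 2 * C0 / 32) by (eapply Rle_trans; [apply Rmin_r|apply Rmin_l]).
assert (k1 : k <= 1 / 2) by (eapply Rle_trans; [apply Rmin_r|apply Rmin_r]).
clearbody k.
set (q := 1 - k).
set (H := fun s : C => (2 / (1 - q * s) - 1 - C0)%C).
set (Bd := 2 / k + 2).
assert (HBd : 2 < Bd) by (unfold Bd; assert (0 < 2 / k) by (apply Rdiv_lt_0_compat; lra); lra).
(* d * Bd <= k settles |s| <= 1 - k by (1 - k)(1 + k) <= 1. Near the circle, d * Bd ^ 2 <= C0 lets
   the first-order loss d * C0 absorb the second-order term. *)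
set (d := Rmin (k / Bd) (C0 / Bd ^ 2)).
assert (Bd2 : 0 < Bd ^ 2) by (apply pow_lt; lra).
assert (d0 : 0 < d) by (unfold d; apply Rmin_pos; apply Rdiv_lt_0_compat; lra).
assert (d1 : d * Bd <= k).
{ apply Rle_trans with (k / Bd * Bd); [apply Rmult_le_compat_r; [lra|apply Rmin_l]|right; field; lra]. }
assert (d2 : d * Bd ^ 2 <= C0).
{ apply Rle_trans with (C0 / Bd ^ 2 * Bd ^ 2); [apply Rmult_le_compat_r; [lra|apply Rmin_r]|right; field; lra]. }
clearbody d.
assert (den : forall s, Cmod s <= 1 -> k <= Cmod (1 - q * s)).
{ intros s Hs; pose proof (Cmod_triangle_rev 1 (1 - q * s)) as T.
  replace (1 - q * s - 1)%C with (- (q * s))%C in T by ring.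
  rewrite Cmod_1, Cmod_opp, Cmod_mult, Cmod_R, Rabs_pos_eq in T by (unfold q; lra).
  assert (q * Cmod s <= q * 1) by (apply Rmult_le_compat_l; unfold q; lra). unfold q in *; lra. }
assert (den0 : forall s, Cmod s <= 1 -> (1 - q * s)%C <> 0%C).
{ intros s Hs; apply Cmod_gt_0; specialize (den s Hs); lra. }
assert (ES : forall s, Cmod s <= 1 ->
  (RtoC (1 - d * (1 + C0)) + RtoC (2 * d) * / (1 - q * s))%C = (1 + d * H s)%C).
{ intros s Hs; unfold H; rewrite RtoC_minus, !RtoC_mult, RtoC_plus; field; apply den0; exact Hs. }
assert (BH : forall s, Cmod s <= 1 -> Cmod (H s) <= Bd).
{ intros s Hs; unfold H, Bd.
  replace (2 / (1 - q * s) - 1 - C0)%C with (2 / (1 - q * s) + - (1 + C0))%C by ring.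
  eapply Rle_trans; [apply Cmod_triangle|].
  rewrite <- RtoC_plus, Cmod_opp, Cmod_div, !Cmod_R, !Rabs_pos_eq by (auto; lra).
  apply Rplus_le_compat; [|lra].
  unfold Rdiv; apply Rmult_le_compat_l; [lra|]; apply Rinv_le_contravar; auto. }
(* The partial fraction form of 1 + d * H s. *)
exists (1 - d * (1 + C0)), (2 * d), q; split; [unfold q; lra|split].
- rewrite ES by lra.
  assert (R : 2 * C0 <= Re (2 / (1 - q * c) - 1)%C).
  { pose proof (Re_herglotz q c (den0 c ltac:(lra))) as E.
    assert (D2 : Cmod (1 - q * c) <= 2).
    { replace (1 - q * c)%C with (1 + - (q * c))%C by ring.
      eapply Rle_trans; [apply Cmod_triangle|].
      rewrite Cmod_1, Cmod_opp, Cmod_mult, Cmod_R, Rabs_pos_eq by (unfold q; lra).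
      assert (q * Cmod c <= 1 * 1) by (apply Rmult_le_compat; unfold q; lra). lra. }
    pose proof (den c ltac:(lra)) as Dk.
    assert (P : 0 < Cmod (1 - q * c) ^ 2 <= 4) by (split; nra).
    assert (Q : 8 * C0 <= 1 - q ^ 2 * Cmod c ^ 2).
    { unfold C0; assert (q ^ 2 <= 1) by (unfold q; nra).
      assert (q ^ 2 * Cmod c ^ 2 <= 1 * Cmod c ^ 2) by (apply Rmult_le_compat_r; [apply pow2_ge_0|lra]). lra. }
    apply Rnot_lt_le; intros L; nra. }
  eapply Rlt_le_trans; [|eapply Rle_trans; [apply Rle_abs|apply re_le_Cmod]].
  assert (E : Re (1 + d * H c)%C = 1 + d * (Re (2 / (1 - q * c) - 1)%C - C0)).
  { unfold H; destruct (2 / (1 - q * c) - 1)%C as [x y]; simpl; ring. }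
  rewrite E; nra.
- intros s Hs Hor; rewrite ES by exact Hs; rewrite Cmod_mult.
  pose proof (Cmod_ge_0 s) as s0; pose proof (BH s Hs) as BHs; pose proof (Cmod_ge_0 (H s)) as H0.
  destruct (Rle_dec (Cmod s) (1 - k)) as [L|L].
  + assert (T : Cmod (1 + d * H s) <= 1 + k).
    { eapply Rle_trans; [apply Cmod_triangle|].
      rewrite Cmod_1, Cmod_mult, Cmod_R, Rabs_pos_eq by lra.
      assert (d * Cmod (H s) <= d * Bd) by (apply Rmult_le_compat_l; lra). lra. }
    apply Rle_trans with ((1 - k) * (1 + k)); [apply Rmult_le_compat; auto using Cmod_ge_0|nra].
  + assert (Hs1 : h <= Cmod (s - 1)) by (destruct Hor; [lra|assumption]).
    assert (D : h / 2 <= Cmod (1 - q * s)).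
    { pose proof (Cmod_triangle (1 - q * s) (- (k * s))) as T.
      replace (1 - q * s + - (k * s))%C with (- (s - 1))%C in T by (unfold q; rewrite RtoC_minus; ring).
      rewrite !Cmod_opp, Cmod_mult, Cmod_R, Rabs_pos_eq in T by lra.
      assert (k * Cmod s <= k * 1) by (apply Rmult_le_compat_l; lra). lra. }
    assert (R : Re (2 / (1 - q * s) - 1)%C <= C0 / 2).
    { pose proof (Re_herglotz q s (den0 s Hs)) as E.
      assert (P : h ^ 2 / 4 <= Cmod (1 - q * s) ^ 2) by nra.
      assert (Q : 1 - q ^ 2 * Cmod s ^ 2 <= 4 * k).
      { assert (1 - 2 * k <= q ^ 2) by (unfold q; nra).
        assert (1 - 2 * k <= Cmod s ^ 2) by nra.
        assert ((1 - 2 * k) * (1 - 2 * k) <= q ^ 2 * Cmod s ^ 2) by (apply Rmult_le_compat; lra). nra. }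
      apply Rnot_lt_le; intros N; nra. }
    assert (E : Cmod (1 + d * H s) ^ 2 = 1 + 2 * d * (Re (2 / (1 - q * s) - 1)%C - C0) + d ^ 2 * Cmod (H s) ^ 2).
    { rewrite !Cmod2_alt; unfold H; destruct (2 / (1 - q * s) - 1)%C as [x y]; simpl; ring. }
    assert (F : Cmod (1 + d * H s) ^ 2 <= 1).
    { assert (Cmod (H s) ^ 2 <= Bd ^ 2) by (apply pow_incr; lra).
      assert (d ^ 2 * Cmod (H s) ^ 2 <= d * C0).
      { apply Rle_trans with (d * (d * Bd ^ 2)); [|apply Rmult_le_compat_l; lra].
        replace (d ^ 2 * Cmod (H s) ^ 2) with (d * (d * Cmod (H s) ^ 2)) by ring.
        repeat apply Rmult_le_compat_l; lra. }
      rewrite E; nra. }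
    pose proof (Cmod_ge_0 (1 + d * H s)).
    assert (Cmod (1 + d * H s) <= 1) by nra. nra.
Qed.

(** Strict convexity of the disk, quantitatively. If |x - y| < h, a midpoint within h / 2 of [t]
    puts both points within h of [t]; if |x - y| >= h, the parallelogram law pulls the midpoint away
    from the circle. *)
Lemma midpoint_dichotomy (x y t : C) (h : R) :
  Cmod x <= 1 -> Cmod y <= 1 -> 0 < h -> ~ (Cmod (x - t) < h /\ Cmod (y - t) < h) ->
  Cmod ((x + y) / 2) <= 1 - h ^ 2 / 8 \/ h / 2 <= Cmod ((x + y) / 2 - t).
Proof.
intros Hx Hy Hh N.
destruct (Rle_dec (h / 2) (Cmod ((x + y) / 2 - t))) as [L|L]; [right; exact L|left].
apply Rnot_le_lt in L.
assert (D : h <= Cmod (x - y)).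
{ assert (Ed : Cmod ((x - y) / 2) = Cmod (x - y) / 2).
  { rewrite Cmod_div by (apply RtoC_neq_0; lra); rewrite Cmod_R, Rabs_pos_eq by lra; reflexivity. }
  apply Rnot_lt_le; intros D; apply N; split.
  - pose proof (Cmod_triangle ((x - y) / 2) ((x + y) / 2 - t)) as T.
    replace ((x - y) / 2 + ((x + y) / 2 - t))%C with (x - t)%C in T by field. lra.
  - pose proof (Cmod_triangle (- ((x - y) / 2)) ((x + y) / 2 - t)) as T.
    replace (- ((x - y) / 2) + ((x + y) / 2 - t))%C with (y - t)%C in T by field.
    rewrite Cmod_opp in T. lra. }
assert (E : Cmod ((x + y) / 2) ^ 2 = (Cmod x ^ 2 + Cmod y ^ 2) / 2 - Cmod (x - y) ^ 2 / 4).
{ rewrite !Cmod2_alt; destruct x, y; simpl; field. }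
pose proof (Cmod_ge_0 x); pose proof (Cmod_ge_0 y); pose proof (Cmod_ge_0 ((x + y) / 2)).
assert (Cmod x ^ 2 <= 1) by nra. assert (Cmod y ^ 2 <= 1) by nra.
assert (h ^ 2 <= Cmod (x - y) ^ 2) by (apply pow_incr; lra).
assert (h ^ 2 <= 4) by nra.
apply Rnot_lt_le; intros F.
assert ((1 - h ^ 2 / 8) ^ 2 < Cmod ((x + y) / 2) ^ 2) by nra.
nra.
Qed.

(** * The boundary curve *)


Lemma sup_mod_ge (V : C * C -> Prop) (f : C * C -> C) (z : C * C) :
  V z -> Rbar_le (Cmod (f z)) (sup_mod V f).
Proof. intros Hz; apply (Lub_Rbar_correct _); exists z; auto. Qed.

Lemma sup_mod_le (V : C * C -> Prop) (f : C * C -> C) (M : R) :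
  (forall z, V z -> Cmod (f z) <= M) -> Rbar_le (sup_mod V f) M.
Proof. intros H; apply (Lub_Rbar_correct _); intros r (z & Hz & ->); apply H; exact Hz. Qed.

Lemma Cconj_mult_1 (u : C) : Cmod u = 1 -> (Cconj u * u)%C = 1%C.
Proof. intros H; rewrite Cmult_comm, <- Cmod2_conj, H, pow1; reflexivity. Qed.

(* Inverses of the coordinate changes m(z) = mobius a z and n(w) = u mobius a w. *)
Definition curve1 (a : C) (t : C) : C := mobius (- a) t.
Definition curve2 (a u : C) (t : C) : C := mobius (- a) (Cconj u * t).

Lemma curve1_K (a t : C) : Cmod a < 1 -> Cmod t <= 1 -> mobius a (curve1 a t) = t.
Proof.
intros Ha Ht; unfold curve1; pose proof (mobius_opp_K (- a)%C t) as E.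
replace (- - a)%C with a in E by ring; apply E; rewrite ?Cmod_opp; auto.
Qed.

Lemma curve2_K (a u t : C) : Cmod a < 1 -> Cmod u = 1 -> Cmod t <= 1 ->
  (u * mobius a (curve2 a u t))%C = t.
Proof.
intros Ha Hu Ht; unfold curve2; fold (curve1 a (Cconj u * t)).
rewrite curve1_K by (rewrite ?Cmod_mult, ?Cmod_conj, ?Hu; lra).
rewrite Cmult_assoc, (Cmult_comm u), Cconj_mult_1 by exact Hu; apply Cmult_1_l.
Qed.

Lemma curve_bidisk (a1 a2 u t : C) : Cmod a1 < 1 -> Cmod a2 < 1 -> Cmod u = 1 -> Cmod t < 1 ->
  bidisk (curve1 a1 t, curve2 a2 u t).
Proof.
intros; split; apply mobius_lt_1; rewrite ?Cmod_opp, ?Cmod_mult, ?Cmod_conj; try assumption.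
replace (Cmod u) with 1; lra.
Qed.

Lemma cdiff_curve1 (a t : C) : Cmod a < 1 -> Cmod t <= 1 -> cdiff (curve1 a) t.
Proof. intros Ha Ht; apply cdiff_mobius; rewrite ?Cmod_opp; auto. Qed.

Lemma cdiff_curve2 (a u t : C) : Cmod a < 1 -> Cmod u = 1 -> Cmod t <= 1 -> cdiff (curve2 a u) t.
Proof.
intros Ha Hu Ht; apply (cdiff_comp (mobius (- a)) (fun t => Cconj u * t)%C).
- apply cdiff_mobius; rewrite ?Cmod_opp, ?Cmod_mult, ?Cmod_conj, ?Hu; lra.
- apply cdiff_mult; [apply cdiff_const|apply cdiff_id].
Qed.

Lemma poly_approx_mobius (a : C) (p : C * C -> C) :
  Cmod a < 1 -> polynomial2 p -> (forall z, bidisk z -> Cmod (p z) <= 1) ->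
  poly_approx (fun z => mobius a (p z)).
Proof.
intros Ha Hp B; unfold mobius, Cdiv; apply poly_approx_mult.
- apply poly_approx_plus; apply poly_approx_poly; [exact Hp|apply polynomial2_const].
- apply (poly_approx_geometric (fun z => Cconj a * p z)%C (Cmod a)); [|exact Ha|].
  + apply poly_approx_mult; apply poly_approx_poly; [apply polynomial2_const|exact Hp].
  + intros z Hz; rewrite Cmod_mult, Cmod_conj.
    rewrite <- (Rmult_1_r (Cmod a)) at 2; apply Rmult_le_compat_l; auto using Cmod_ge_0.
Qed.

(* If V missed a neighbourhood of the boundary point at t, then with phi = (m(z) + n(w))/2 a peak
   factor S(phi) could be inserted: phi S(phi) has modulus at most 1 on V but is too large at the
   second node for the Schwarz lemma on the extension. *)
Lemma boundary_curve_in_closure (V : C * C -> Prop) (a1 a2 u c t : C) (eta : R) :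
  (forall z, V z -> bidisk z) -> poly_extension_property V ->
  Cmod a1 < 1 -> Cmod a2 < 1 -> Cmod u = 1 -> 0 < Cmod c < 1 ->
  V (a1, a2) -> V (curve1 a1 c, curve2 a2 u c) -> Cmod t = 1 -> 0 < eta ->
  exists v, V v /\ Cmod (fst v - curve1 a1 t) < eta /\ Cmod (snd v - curve2 a2 u t) < eta.
Proof.
intros V_sub V_ext Ha1 Ha2 Hu Hc Va Vc Ht Heta.
apply NNPP; intros N.
destruct (cdiff_ccont _ _ (cdiff_curve1 a1 t Ha1 (Req_le _ _ Ht)) eta Heta) as (h1 & Hh1 & B1).
destruct (cdiff_ccont _ _ (cdiff_curve2 a2 u t Ha2 Hu (Req_le _ _ Ht)) eta Heta) as (h2 & Hh2 & B2).
set (h := Rmin h1 h2).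
assert (Hh : 0 < h) by (apply Rmin_pos; auto).
assert (hl1 : h <= h1) by apply Rmin_l. assert (hl2 : h <= h2) by apply Rmin_r.
assert (Htc : Cmod (Cconj t) = 1) by (rewrite Cmod_conj; exact Ht).
set (phi := fun z : C * C => ((mobius a1 (fst z) + u * mobius a2 (snd z)) / 2)%C).
(* Rotated so that the value [t] of [phi] goes to 1, where [peak_multiplier] has its peak. *)
set (sg := fun z => (Cconj t * phi z)%C).
assert (Bphi : forall z, bidisk z -> Cmod (phi z) <= 1).
{ intros z [Hz1 Hz2]; unfold phi; rewrite Cmod_div by (apply RtoC_neq_0; lra).
  rewrite Cmod_R, Rabs_pos_eq by lra.
  pose proof (Cmod_triangle (mobius a1 (fst z)) (u * mobius a2 (snd z))) as T.
  rewrite Cmod_mult, Hu in T.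
  pose proof (mobius_lt_1 a1 (fst z) Ha1 Hz1); pose proof (mobius_lt_1 a2 (snd z) Ha2 Hz2); lra. }
assert (Bsg : forall z, bidisk z -> Cmod (sg z) <= 1).
{ intros z Hz; unfold sg; rewrite Cmod_mult, Htc, Rmult_1_l; auto. }
assert (Hc' : Cmod (Cconj t * c) < 1) by (rewrite Cmod_mult, Htc; lra).
(* The gaps h^2 / 8 and h / 2 are those of [midpoint_dichotomy]. *)
destruct (peak_multiplier (Cconj t * c) (h ^ 2 / 8) (h / 2) Hc') as (A & B & q & Hq & Hbig & Hpeak);
  [assert (0 < h ^ 2) by (apply pow_lt; exact Hh); lra|lra|].
set (Psi := fun z => (sg z * (A + B * / (1 - q * sg z)))%C).
assert (PsiV : forall z, V z -> Cmod (Psi z) <= 1).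
{ intros z Hz; pose proof (V_sub z Hz) as [Hz1 Hz2]; unfold Psi; apply Hpeak; [apply Bsg; split; auto|].
  pose proof (mobius_lt_1 a1 (fst z) Ha1 Hz1) as X1; pose proof (mobius_lt_1 a2 (snd z) Ha2 Hz2) as X2.
  destruct (midpoint_dichotomy (mobius a1 (fst z)) (u * mobius a2 (snd z)) t h) as [L|L].
  - lra.
  - rewrite Cmod_mult, Hu; lra.
  - exact Hh.
  - intros [L1 L2]; apply N; exists z; split; [exact Hz|split].
    + specialize (B1 _ (Rlt_le_trans _ _ _ L1 hl1)).
      unfold curve1 at 1 in B1; rewrite mobius_opp_K in B1 by (auto; apply Rlt_le; exact Hz1); exact B1.
    + specialize (B2 _ (Rlt_le_trans _ _ _ L2 hl2)).
      unfold curve2 at 1 in B2; rewrite Cmult_assoc, Cconj_mult_1, Cmult_1_l in B2 by exact Hu.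
      rewrite mobius_opp_K in B2 by (auto; apply Rlt_le; exact Hz2); exact B2.
  - left; unfold sg; rewrite Cmod_mult, Htc, Rmult_1_l; exact L.
  - right; unfold sg.
    replace (Cconj t * phi z - 1)%C with (Cconj t * (phi z - t))%C
      by (rewrite <- (Cconj_mult_1 t Ht); ring).
    rewrite Cmod_mult, Htc, Rmult_1_l; exact L. }
assert (Asg : poly_approx sg).
{ unfold sg, phi, Cdiv; apply poly_approx_mult; [apply poly_approx_poly, polynomial2_const|].
  apply poly_approx_mult; [|apply poly_approx_poly, polynomial2_const].
  apply poly_approx_plus; [|apply poly_approx_mult; [apply poly_approx_poly, polynomial2_const|]].
  - apply poly_approx_mobius; auto using polynomial2_fst. intros z [Hz _]; apply Rlt_le, Hz.
  - apply poly_approx_mobius; auto using polynomial2_snd. intros z [_ Hz]; apply Rlt_le, Hz. }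
assert (APsi : poly_approx Psi).
{ unfold Psi; apply poly_approx_mult; [exact Asg|].
  apply poly_approx_plus; [apply poly_approx_poly, polynomial2_const|].
  apply poly_approx_mult; [apply poly_approx_poly, polynomial2_const|].
  apply (poly_approx_geometric (fun z => q * sg z)%C q); [|lra|].
  - apply poly_approx_mult; [apply poly_approx_poly, polynomial2_const|exact Asg].
  - intros z Hz; rewrite Cmod_mult, Cmod_R, Rabs_pos_eq by lra.
    pose proof (Bsg z Hz); nra. }
assert (Psi_a : Psi (a1, a2) = 0%C).
{ unfold Psi, sg, phi; simpl; rewrite !mobius_self; unfold Cdiv; ring. }
assert (sg_c : sg (curve1 a1 c, curve2 a2 u c) = (Cconj t * c)%C).
{ unfold sg, phi; simpl; rewrite curve1_K, curve2_K by (auto; lra); field. }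
set (S := Cmod (A + B * / (1 - q * (Cconj t * c)))) in *.
assert (Psi_c : Cmod (Psi (curve1 a1 c, curve2 a2 u c)) = Cmod c * S).
{ unfold Psi; rewrite sg_c, !Cmod_mult, Htc, Rmult_1_l; reflexivity. }
(* The errors below add up to less than 4 * eps, half of the gain |c| (S - 1). *)
set (eps := Cmod c * (S - 1) / 8).
assert (Heps : 0 < eps) by (unfold eps; apply Rdiv_lt_0_compat; [apply Rmult_lt_0_compat; lra|lra]).
destruct (APsi eps Heps) as (P & HP & BP).
destruct (V_ext P HP) as (G & HG & _ & GV & Gsup).
assert (PV : forall z, V z -> Cmod (P z) <= 1 + eps).
{ intros z Hz; pose proof (PsiV z Hz); specialize (BP z (V_sub z Hz)).
  pose proof (Cmod_triangle (Psi z) (- (Psi z - P z))) as T.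
  replace (Psi z + - (Psi z - P z))%C with (P z) in T by ring; rewrite Cmod_opp in T; lra. }
(* Here the equality of suprema enters: the bound on [V] passes to the whole bidisk. *)
assert (BG : forall z, bidisk z -> Cmod (G z) <= 1 + eps).
{ intros z Hz; change (Rbar_le (Cmod (G z)) (1 + eps)).
  apply Rbar_le_trans with (sup_mod bidisk G); [apply sup_mod_ge; exact Hz|].
  rewrite Gsup; apply sup_mod_le; exact PV. }
set (K := fun s => G (curve1 a1 s, curve2 a2 u s)).
assert (K0 : Cmod (K 0%C) <= eps).
{ unfold K; replace (curve1 a1 0%C) with a1 by (symmetry; apply mobius_opp_0).
  replace (curve2 a2 u 0%C) with a2 by (symmetry; unfold curve2; rewrite Cmult_0_r; apply mobius_opp_0).
  rewrite GV by exact Va; specialize (BP (a1, a2) (V_sub _ Va)); rewrite Psi_a in BP.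
  replace (0 - P (a1, a2))%C with (- P (a1, a2))%C in BP by ring; rewrite Cmod_opp in BP; exact BP. }
assert (Kc : Cmod c * S - eps <= Cmod (K c)).
{ unfold K; rewrite GV by exact Vc; specialize (BP _ (V_sub _ Vc)).
  rewrite <- Psi_c.
  match goal with |- Cmod (Psi ?x) - _ <= _ => pose proof (Cmod_triangle (Psi x - P x) (P x)) as T;
    replace (Psi x - P x + P x)%C with (Psi x) in T by ring end.
  lra. }
(* [K] vanishes at 0 only up to eps, so K 0 is subtracted, which raises the bound to 1 + 2 * eps. *)
pose proof (schwarz (fun s => K s - K 0)%C (1 + 2 * eps) c) as Sch; cbv beta in Sch.
assert (L : Cmod (K c - K 0%C) <= (1 + 2 * eps) * Cmod c).
{ apply Sch; [| |ring|lra].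
  - intros s Hs; apply cdiff_minus; [|apply cdiff_const].
    apply holomorphic_bidisk_curve; [exact HG|apply curve_bidisk; auto|
      apply cdiff_curve1; auto; lra|apply cdiff_curve2; auto; lra].
  - intros s Hs; unfold Cminus; eapply Rle_trans; [apply Cmod_triangle|]; rewrite Cmod_opp.
    assert (Cmod (K s) <= 1 + eps) by (apply BG, curve_bidisk; auto). lra. }
pose proof (Cmod_triangle (K c - K 0%C) (K 0%C)) as T.
replace (K c - K 0 + K 0)%C with (K c) in T by ring.
assert (eps * Cmod c <= eps * 1) by (apply Rmult_le_compat_l; lra).
assert (8 * eps = Cmod c * S - Cmod c) by (unfold eps; field).
lra.
Qed.

(** In the Moebius coordinates [f] is a self-map of the disk fixing 0 and [c], hence the identity by
    the equality case of the Schwarz lemma. *)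
Lemma disk_interpolant_eq (a1 a2 b1 b2 u c : C) (f : C -> C) :
  Cmod a1 < 1 -> Cmod a2 < 1 -> Cmod b1 < 1 -> Cmod u = 1 -> 0 < Cmod c < 1 ->
  mobius a1 b1 = c -> (u * mobius a2 b2)%C = c ->
  disk_interpolant (a1, a2) (b1, b2) f ->
  forall z, disk z -> f z = curve2 a2 u (mobius a1 z).
Proof.
intros Ha1 Ha2 Hb1 Hu Hc E1 E2 (Hf & Df & Fa & Fb) z Hz; simpl in Fa, Fb.
assert (in1 : forall t, Cmod t < 1 -> disk (curve1 a1 t)).
{ intros t Ht; apply mobius_lt_1; rewrite ?Cmod_opp; auto. }
assert (EK : (u * mobius a2 (f (curve1 a1 (mobius a1 z))))%C = mobius a1 z).
{ apply (schwarz_eq (fun t => u * mobius a2 (f (curve1 a1 t)))%C c); auto.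
  - intros t Ht; apply cdiff_mult; [apply cdiff_const|].
    apply (cdiff_comp (mobius a2) (fun t => f (curve1 a1 t))).
    + apply cdiff_mobius; auto; apply Rlt_le, Df, in1, Ht.
    + apply (cdiff_comp f (curve1 a1)); [apply cdiff_ex_derive, Hf, in1, Ht|apply cdiff_curve1; auto; lra].
  - intros t Ht; rewrite Cmod_mult, Hu, Rmult_1_l; apply Rlt_le, mobius_lt_1; auto; apply Df, in1, Ht.
  - replace (curve1 a1 0%C) with a1 by (symmetry; apply mobius_opp_0).
    rewrite Fa, mobius_self; apply Cmult_0_r.
  - replace (curve1 a1 c) with b1; [rewrite Fb; exact E2|].
    rewrite <- E1; symmetry; apply mobius_opp_K; auto; lra.
  - apply mobius_lt_1; auto. }
unfold curve1 in EK; rewrite mobius_opp_K in EK by (auto; apply Rlt_le; exact Hz).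
rewrite <- EK at 1; unfold curve2.
rewrite Cmult_assoc, Cconj_mult_1, Cmult_1_l by exact Hu.
symmetry; apply mobius_opp_K; auto; apply Rlt_le, Df, Hz.
Qed.

Theorem theorem1p19 (V : C * C -> Prop)
    (V_sub : forall z : C * C, V z -> bidisk z)
    (V_convex : rel_poly_convex V)
    (V_ext : poly_extension_property V) :
  balanced V.
Proof.
intros [a1 a2] [b1 b2] Va Vb ([Ha1 Ha2] & [Hb1 Hb2] & Hne & Hd) w (f & Hf & z & Hz & ->).
unfold disk in Ha1, Ha2, Hb1, Hb2; simpl in Ha1, Ha2, Hb1, Hb2.
set (c := mobius a1 b1); set (c2 := mobius a2 b2).
assert (Em : forall x y, pseudo_hyp x y = Cmod (mobius x y)).
{ intros x y; unfold pseudo_hyp, mobius, Cdiv.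
  replace (x - y)%C with (- (y - x))%C by ring; rewrite !Cmod_mult, Cmod_opp; reflexivity. }
rewrite !Em in Hd; simpl in Hd; fold c c2 in Hd.
assert (m0 : forall x y, Cmod x < 1 -> Cmod y < 1 -> mobius x y = 0%C -> x = y).
{ intros x y Hx Hy E; rewrite <- (mobius_opp_K x y), E by (auto; lra); symmetry; apply mobius_opp_0. }
(* If c were 0, balance would give c2 = 0 as well, and the two nodes would coincide. *)
assert (Hc : 0 < Cmod c < 1).
{ split; [|apply mobius_lt_1; auto].
  destruct (Cmod_ge_0 c) as [|E]; [assumption|exfalso; apply Hne].
  rewrite (m0 a1 b1), (m0 a2 b2); auto; apply Cmod_eq_0; [|symmetry; exact E].
  fold c2; rewrite <- Hd; symmetry; exact E. }
assert (c20 : c2 <> 0%C) by (apply Cmod_gt_0; rewrite <- Hd; apply Hc).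
(* Unimodular precisely because the pair is balanced; it aligns the second node with (c, c). *)
set (u := (c / c2)%C).
assert (Hu : Cmod u = 1) by (unfold u; rewrite Cmod_div, Hd by exact c20; field; lra).
assert (E2 : (u * mobius a2 b2)%C = c) by (fold c2; unfold u; field; exact c20).
rewrite (disk_interpolant_eq a1 a2 b1 b2 u c f) by auto.
assert (Vc : V (curve1 a1 c, curve2 a2 u c)).
{ replace (curve1 a1 c) with b1 by (symmetry; apply mobius_opp_K; auto; lra).
  replace (curve2 a2 u c) with b2; [exact Vb|].
  unfold curve2; rewrite <- E2, Cmult_assoc, Cconj_mult_1, Cmult_1_l by exact Hu.
  symmetry; apply mobius_opp_K; auto; lra. }
set (t := mobius a1 z).
assert (Ht : Cmod t < 1) by (apply mobius_lt_1; auto).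
replace z with (curve1 a1 t) by (apply mobius_opp_K; auto; apply Rlt_le; exact Hz).
apply V_convex; split; [|apply curve_bidisk; auto].
intros p Hp; pose proof (fun v Hv => sup_mod_ge V p v Hv) as Hsup.
(* An infinite supremum makes the hull inequality trivial, and minus infinity is excluded by the
   point (a1, a2) of [V]. *)
destruct (sup_mod V p) as [M| |]; [|exact I|exact (Hsup _ Va)].
simpl in Hsup |- *.
apply (max_principle (fun s => p (curve1 a1 s, curve2 a2 u s))); [| |exact Ht].
- intros s Hs; apply polynomial2_cdiff; [exact Hp|apply cdiff_curve1|apply cdiff_curve2]; auto.
(* Points of [V] accumulate at each boundary point of the curve, so by continuity |p| <= M there. *)
- intros s Hs; apply le_epsilon; intros eps Heps.
  destruct (polynomial2_continuous p (curve1 a1 s, curve2 a2 u s) eps Hp Heps) as (d & Hd0 & Bd).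
  destruct (boundary_curve_in_closure V a1 a2 u c s d) as (v & Vv & L1 & L2); auto.
  specialize (Bd v L1 L2); specialize (Hsup v Vv).
  pose proof (Cmod_triangle_rev (p (curve1 a1 s, curve2 a2 u s)) (p v)); lra.
Qed.
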